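(* Let $m>0$, $g>0$, $\tau>0$, and let $F_x,F_y:\mathbb{R}\to\mathbb{R}$ and $B:\mathbb{R}\to\mathbb{R}^3$ be continuous $\tau$-periodic functions. Put $F(t)=F_x(t)e_x+F_y(t)e_y$. Consider the equation of motion of a spherical pendulum in a magnetic field, in the presence of viscous friction with coefficient $\mu>0$ and of the additional horizontal force $F$: $$m\ddot\rho=-\mu\dot\rho+F_x(t)e_x+F_y(t)e_y+R+[\dot\rho,B(t)]-mg\,e_z .$$ Let $c>0$ be a constant such that for every vector $v\in\mathbb{R}^3$ with $v\perp e_z$ and $\tfrac{m}{2}(v,v)\le c$ one has $$([v,B(t)],e_z)<mg\quad\text{for all } t.$$ Then for any $$\mu>\max_{t\in[0,\tau]}\sqrt{\frac{m}{2c}}\,\bigl(|F(t)|+mg\bigr)$$ there exists a $\tau$-periodic solution $\rho(t)$ of the equation of motion such that $(\rho(t),e_z)>0$ for all $t\in\mathbb{R}$.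
   Context: $e_x,e_y,e_z$ is the standard orthonormal basis of $\mathbb{R}^3$ ($e_z$ points vertically upward), $(\cdot,\cdot)$ is the Euclidean scalar product, $|\cdot|$ the Euclidean norm, and $[\cdot,\cdot]$ the cross product in $\mathbb{R}^3$. A spherical pendulum is a point mass $m$ with position $\rho\in\mathbb{R}^3$ constrained to a sphere centred at the origin (of fixed radius $\ell>0$, the length of the rod); the phase space is the tangent bundle $T\mathbb{S}^2$ of the sphere. $R$ is the constraint reaction force, directed along the normal to the sphere at $\rho$. Thus a solution is a twice differentiable curve $\rho(t)$ on the sphere such that $m\ddot\rho$ minus the sum of all right-hand-side terms other than $R$ is a scalar multiple of $\rho(t)$ for every $t$. $B$ is the magnetic field (depending only on time) and $g$ is the gravity acceleration. *)

(* Defs.v *)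
From HB Require Import structures.
From mathcomp Require Import all_boot all_order all_algebra.
From mathcomp Require Import all_classical all_reals all_analysis.
Set Implicit Arguments.
Unset Strict Implicit.
Unset Printing Implicit Defensive.
Import Order.TTheory GRing.Theory Num.Theory.
Import numFieldNormedType.Exports.
Local Open Scope classical_set_scope.
Local Open Scope ring_scope.

Section Euclidean3.
Variable R : realType.
Implicit Types u v : 'rV[R]_3.

Definition e_x : 'rV[R]_3 := delta_mx 0 (inord 0).
Definition e_y : 'rV[R]_3 := delta_mx 0 (inord 1).
Definition e_z : 'rV[R]_3 := delta_mx 0 (inord 2).

Definition dot u v : R := \sum_(i < 3) u 0 i * v 0 i.

(* The library norm on 'rV[R]_3 is the sup norm, so the Euclidean norm has to
   be introduced separately; both induce the same topology and derivatives. *)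
Definition enorm u : R := Num.sqrt (dot u u).

Definition cross u v : 'rV[R]_3 :=
  let x w := dot w e_x in let y w := dot w e_y in let z w := dot w e_z in
  (y u * z v - z u * y v) *: e_x
  + (z u * x v - x u * z v) *: e_y
  + (x u * y v - y u * x v) *: e_z.

Definition horizontal_force (Fx Fy : R -> R) (t : R) : 'rV[R]_3 :=
  Fx t *: e_x + Fy t *: e_y.

(* The constraint reaction is not prescribed: it is whatever normal vector
   lambda *: rho t, at each time t, balances the equation of motion. *)
Definition pendulum_solution (l m g mu : R) (F B rho : R -> 'rV[R]_3) : Prop :=
  [/\ forall t, enorm (rho t) = l,
      forall t, derivable rho t 1,
      forall t, derivable (derive1 rho) t 1
    & forall t, exists lambda : R,
        m *: derive1 (derive1 rho) t =
          - (mu *: derive1 rho t) + F t + lambda *: rho t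
          + cross (derive1 rho t) (B t) - (m * g) *: e_z].

End Euclidean3.

Arguments e_x {R}.
Arguments e_y {R}.
Arguments e_z {R}.

(* Main.v *)
Require Import Defs.
From HB Require Import structures.
From mathcomp Require Import all_boot all_order all_algebra.
From mathcomp Require Import all_classical all_reals all_analysis.
From mathcomp Require Import ring lra.

(* The closed upper hemisphere is continued below the equator by a cylinder, and the equation of
   motion is extended to the resulting surface, which is homeomorphic to a plane, in such a way
   that friction keeps the kinetic energy below [c] and everything deep in the cylinder sinks.
   Over one period, velocities are therefore confined to a ball and positions are repelled by the
   rim of a large disc, so that Brouwer's theorem yields a periodic motion of the extended system.
   At a lowest point on or below the equator the velocity would be admissible in the hypothesis
   on [B] and the vertical acceleration would be negative; hence the periodic motion stays
   strictly above the equator, where it solves the original equation.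
   Brouwer's theorem comes from the Poincare-Miranda theorem: for 0-cochains [f_i] on a grid that
   are 0 and 1 on opposite faces, the cup product of the coboundaries of the [f_i], summed over
   the grid modulo 2, is 1 by Stokes, so that some cell sees every [f_i] change. *)

(** * Cup products on a grid, modulo 2 *)

(** Two obstacles shape the extension. Velocities at different points lie in different planes, while
    Brouwer's theorem asks for a product of balls; and the curvature jumps where the hemisphere
    meets the cylinder, so an equation for the velocity itself would be discontinuous there. Writing
    the velocity as [w x N] with a free vector [w] of R^3 removes both, at the price of one
    redundant component, the spin [(w, N)], which is given its own friction. The fixed point is
    therefore sought in dimension 2 + 3. Constants: [V = sqrt (2 c / m)] is the speed with kinetic
    energy [c], and the bound on [mu] amounts to [|F| + m g < mu V], that is, at this speed friction
    beats the power of the other forces. Since [l^2 |w|^2 = |v|^2 + (w, N)^2] on the surface, the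
    ball of the [w] has radius [W = V / l]. With [K = V + 1] the downward drift [K * zminus] exceeds
    every admissible vertical velocity from depth 1 on. Horizontal motion is unchanged down to depth
    1 and frozen from depth 2 on, so a lowest point of a periodic motion cannot meet the modified
    horizontal dynamics. *)

Section GridCup.
Variables n k : nat.
Notation pt := {ffun 'I_n -> 'I_k.+1}.
Implicit Types (p : pt) (D : {set 'I_n}) (d e : 'I_n) (js : seq nat).

Local Notation "\xsum_ ( i 'in' A ) F" := (\big[addb/false]_(i in A) F)
  (at level 36, F at level 36, i, A at level 50).
Local Notation "\xsum_ ( i | P ) F" := (\big[addb/false]_(i | P) F)
  (at level 36, F at level 36, i at level 50, P at level 200).

(** The default value of [inord] makes a step beyond [k] land on 0; commutation of steps and the
    cocycle identity then hold with no range condition. *)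
Definition gstep p d : pt := [ffun i => if i == d then inord (p i).+1 else p i].
Definition gback p d : pt := [ffun i => if i == d then inord (p i).-1 else p i].

Variable f : nat -> pt -> bool.

(* Value modulo 2 of the cup product of the coboundaries of the 0-cochains [f j],
   [j] in [js], on the cube with least vertex [p] and directions [D]. *)
Fixpoint cup js p D : bool :=
  if js is j :: js' then
    \xsum_(d in D) ((f j (gstep p d) (+) f j p) && cup js' (gstep p d) (D :\ d))
  else true.

Lemma gstepC p d e : gstep (gstep p d) e = gstep (gstep p e) d.
Proof.
apply/ffunP => i; rewrite !ffunE; case: (altP (i =P d)) => [->|nid];
  case: (altP (_ =P e)) => //.
Qed.

Lemma xsum_addb (I : finType) (P : pred I) (F G : I -> bool) :
  \xsum_(i | P i) (F i (+) G i) = (\xsum_(i | P i) F i) (+) (\xsum_(i | P i) G i).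
Proof. exact: big_split. Qed.

Lemma xsum_andl (I : finType) (P : pred I) (b : bool) (F : I -> bool) :
  \xsum_(i | P i) (b && F i) = b && \xsum_(i | P i) F i.
Proof. by rewrite big_distrr. Qed.

(** Each unordered pair of directions is counted twice, hence contributes zero modulo 2. *)
Lemma xsum_sym D (H : 'I_n -> 'I_n -> bool) :
  (forall d e, H d e = H e d) ->
  \xsum_(d in D) \xsum_(e in D :\ d) H d e = false.
Proof.
move=> Hs.
have -> : \xsum_(d in D) \xsum_(e in D :\ d) H d e =
   (\xsum_(d in D) \xsum_(e | (e \in D) && (e < d)) H d e) (+)
   (\xsum_(d in D) \xsum_(e | (e \in D) && (d < e)) H d e).
  rewrite -xsum_addb; apply: eq_bigr => d dD.
  rewrite (bigID (fun e : 'I_n => e < d)) /=; congr (_ (+) _); apply: eq_bigl => e;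
    rewrite !inE -(inj_eq val_inj) /=; case: (ltngtP e d); rewrite ?andbF ?andbT //=.
set A := (X in X (+) _); set B := (X in _ (+) X).
suff -> : A = B by rewrite addbb.
rewrite /A /B (exchange_big_dep (mem D)) /=; last by move=> i j _ /andP[].
apply: eq_bigr => d dD; apply: eq_big => e; last by [].
by rewrite dD.
Qed.

(* A cup product of coboundaries is a cocycle. *)
Lemma cup_closed js p D :
  \xsum_(d in D) cup js (gstep p d) (D :\ d) = \xsum_(d in D) cup js p (D :\ d).
Proof.
elim: js p D => [|j js IH] p D //=.
under eq_bigr => d dD.
  under eq_bigr => e eD do rewrite andb_addl.
  rewrite xsum_addb xsum_andl; over.
(* The terms at the vertex two steps away are symmetric in the two directions and cancel. On the
   other side the terms with [f j p] cancel likewise, and what is left agrees after exchanging the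
   sums and using induction at the stepped vertex. *)
rewrite xsum_addb xsum_sym; last first.
  by move=> d e; rewrite gstepC !finset.setDDl finset.setUC.
symmetry.
under eq_bigr => d dD.
  under eq_bigr => e eD do rewrite andb_addl.
  rewrite xsum_addb xsum_andl IH; over.
rewrite xsum_addb addbC; congr (_ (+) _).
  rewrite xsum_andl xsum_sym ?andbF // => d e.
  by rewrite !finset.setDDl finset.setUC.
rewrite (exchange_big_dep (mem D)) /=; last by move=> d e _ /setD1P[].
apply: eq_bigr => d dD; rewrite -xsum_andl.
transitivity (\xsum_(e in D :\ d) (f j (gstep p d) && cup js (gstep p d) (D :\ d :\ e))).
  by apply: eq_big => e; [rewrite !inE dD andbT eq_sym andbC | rewrite !finset.setDDl finset.setUC].
by rewrite !xsum_andl IH.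
Qed.

(** Leibniz rule: since the product over [js] is a cocycle, its product with the coboundary of [f j]
    is the coboundary of its product with [f j]. *)
Lemma cup_stokes j js p D :
  cup (j :: js) p D =
  \xsum_(d in D) ((f j (gstep p d) && cup js (gstep p d) (D :\ d))
                  (+) (f j p && cup js p (D :\ d))).
Proof.
rewrite xsum_addb xsum_andl -cup_closed /=.
by under eq_bigr => d dD do rewrite andb_addl; rewrite xsum_addb xsum_andl.
Qed.

(** A cube without direction [d] stays in a hyperplane on which [f j] is constant, so the factor of
    index [j] vanishes on all its edges. *)
Lemma cup_const j js p D d :
  j \in js -> d \notin D ->
  (forall q : pt, q d = p d -> f j q = f j p) -> cup js p D = false.
Proof.
elim: js p D => [|j' js IH] p D //= fin dD fc; rewrite big1 // => e eD.
have nde : d != e by apply: contraNneq dD => ->.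
have pe : gstep p e d = p d by rewrite ffunE (negPf nde).
move: fin; rewrite inE => /predU1P[<-|fin]; first by rewrite (fc (gstep p e)) // addbb.
rewrite (IH (gstep p e) (D :\ e)) ?andbF ?inE ?(negPf dD) ?andbF // => q.
by rewrite pe => /fc ->; rewrite (fc (gstep p e)).
Qed.

(** A nonzero sum has a nonzero summand, that is, an increasing edge path in the cube along which
    each factor changes on its own edge. *)
Lemma cup_change js p D j : cup js p D -> j \in js ->
  (forall d, d \in D -> p d < k) ->
  exists q1 q2 : pt, [/\ f j q1, ~~ f j q2,
    forall i, p i <= q1 i <= p i + (i \in D) &
    forall i, p i <= q2 i <= p i + (i \in D)].
Proof.
elim: js p D => [|j' js IH] p D //= H jin pk.
have [d dD /andP[fd cd]] : exists2 d, d \in D &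
   (f j' (gstep p d) (+) f j' p) && cup js (gstep p d) (D :\ d).
  case: (boolP [exists d in D, (f j' (gstep p d) (+) f j' p) && cup js (gstep p d) (D :\ d)]).
    by case/existsP => d /andP[]; exists d.
  rewrite negb_exists_in => /forall_inP no; move: H; rewrite big1 // => d dD.
  exact/negbTE/no.
have stepd : gstep p d d = (p d).+1 :> nat.
  by rewrite ffunE eqxx inordK // ltnS pk.
have stepn i : i != d -> gstep p d i = p i by move=> nid; rewrite ffunE (negPf nid).
have bnd i : p i <= gstep p d i <= p i + (i \in D).
  by case: (eqVneq i d) => [->|/stepn->]; rewrite ?stepd ?dD ?addn1 ?leqnSn ?leqnn ?leq_addr.
have bnd0 i : p i <= p i <= p i + (i \in D) by rewrite leqnn leq_addr.
move: jin; rewrite inE => /predU1P[->|jin].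
  case E : (f j' p) fd => fd.
    by exists p, (gstep p d); rewrite E; split => //; case: (f _ _) fd.
  by exists (gstep p d), p; rewrite E; split => //; case: (f _ _) fd.
have pk' e : e \in D :\ d -> gstep p d e < k.
  by case/setD1P => /stepn -> /pk.
have [q1 [q2 [f1 f2 b1 b2]]] := IH _ _ cd jin pk'.
have wid (q : pt) : (forall i, gstep p d i <= q i <= gstep p d i + (i \in D :\ d)) ->
    forall i, p i <= q i <= p i + (i \in D).
  move=> bq i; move: (bq i); rewrite !inE; case: (eqVneq i d) => [->|nid] /=.
    by rewrite addn0 stepd dD addn1 => /andP[/ltnW -> ->].
  by rewrite stepn.
by exists q1, q2; split => //; apply: wid.
Qed.

Hypothesis f_lo : forall (i : 'I_n) p, p i = 0 :> nat -> f i p = false.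
Hypothesis f_hi : forall (i : 'I_n) p, p i = k :> nat -> f i p.

Definition gtail (j : nat) : {set 'I_n} := [set d : 'I_n | j <= d].
(** These are the least vertices of the cubes with directions [gtail j] that tile the face where the
    coordinates below [j] equal [k]; the strict bound leaves room for one step. *)
Definition gface (j : nat) p : bool :=
  [forall d : 'I_n, if d < j then p d == k :> nat else p d < k].
Definition gsum (j : nat) : bool :=
  \xsum_(p | gface j p) cup (iota j (n - j)) p (gtail j).

Lemma gsum_last : gsum n = true.
Proof.
rewrite /gsum (big_pred1 [ffun=> ord_max]) ?subnn // => p.
apply/forallP/eqP => [H|-> d]; last by rewrite ltn_ord ffunE /=.
by apply/ffunP => d; rewrite ffunE; apply/val_inj/eqP; move: (H d); rewrite ltn_ord.
Qed.

(** Interior terms cancel in pairs along each line of direction [d]; [Q] ignores coordinate [d], so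
    that whole lines are summed. *)
Lemma telescope (Q : pred pt) (H : pt -> bool) d :
  (forall p q : pt, (forall i, i != d -> p i = q i) -> Q p = Q q) ->
  (\xsum_(p | Q p && (p d < k)) H (gstep p d)) (+) (\xsum_(p | Q p && (p d < k)) H p)
  = (\xsum_(p | Q p && (p d == k :> nat)) H p) (+) (\xsum_(p | Q p && (p d == 0 :> nat)) H p).
Proof.
move=> Qd.
have -> : \xsum_(p | Q p && (p d < k)) H (gstep p d) = \xsum_(p | Q p && (p d != 0 :> nat)) H p.
  symmetry; rewrite (reindex_onto (gstep^~ d) (gback^~ d)) /=; last first.
    move=> p /andP[_ pd]; apply/ffunP => i; rewrite !ffunE.
    case: eqP => // ->; rewrite inordK ?(leq_ltn_trans (leq_pred _)) ?ltn_ord //.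
    by rewrite prednK ?lt0n // inord_val.
  apply: eq_bigl => p.
  have -> : Q (gstep p d) = Q p by apply: Qd => i nid; rewrite ffunE (negPf nid).
  rewrite -andbA; congr andb; rewrite ffunE eqxx.
  case: (ltnP (p d) k) => pd.
    rewrite inordK ?ltnS //=; apply/eqP/ffunP => i; rewrite !ffunE.
    by case: eqP => // ->; rewrite inordK ?ltnS // inord_val.
  (* At [p d = k] the step wraps to 0, which the condition on nonzero coordinates excludes. *)
  apply/negP => /andP[n0 /eqP/ffunP/(_ d)]; rewrite !ffunE eqxx => /(congr1 val) /=.
  have pdk : p d = k :> nat by apply/eqP; rewrite eqn_leq pd -ltnS ltn_ord.
  have {n0} := n0; rewrite /inord /insubd pdk insubF ?ltnn //=.
set A := (X in X (+) _ = _); set B := (X in _ (+) X = _).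
set K := (X in _ = X (+) _); set Z := (X in _ = _ (+) X).
have : A (+) Z = B (+) K.
  transitivity (\xsum_(p | Q p) H p).
    by rewrite (bigID (fun p : pt => p d == 0 :> nat)) /= addbC.
  rewrite (bigID (fun p : pt => p d == k :> nat)) /= addbC; congr (_ (+) _).
  by apply: eq_bigl => p; rewrite ltn_neqAle -ltnS ltn_ord andbT.
by move: A B K Z => [] [] [] [].
Qed.

(* Stokes: only the face where coordinate [j] equals [k] contributes, since [f j] vanishes on the
   opposite face and [f d] is constant on the two faces orthogonal to [d] for [d > j]. *)
Lemma gsum_step j : j < n -> gsum j = gsum j.+1.
Proof.
move=> jn; rewrite /gsum.
have -> : n - j = (n - j.+1).+1 by rewrite subnSK.
rewrite [iota j _]/=; set js := iota j.+1 _.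
under eq_bigr => p _ do rewrite cup_stokes.
rewrite (exchange_big_dep (mem (gtail j))) //=.
pose G d p := f j p && cup js p (gtail j :\ d).
(* [Q d] is the face condition with coordinate [d] forgotten, as [telescope] requires. *)
pose Q d p := [forall e : 'I_n, (e != d) ==> (if e < j then p e == k :> nat else p e < k)].
have faceE d p : d \in gtail j -> gface j p = Q d p && (p d < k).
  rewrite inE => jd; apply/forallP/andP => [H|[/forallP H pd] e].
    split; last by move: (H d); rewrite ltnNge jd.
    by apply/forallP => e; rewrite H implybT.
  by move: (H e); case: eqP => //= -> _; rewrite ltnNge jd.
have Qinv d (p q : pt) : (forall i, i != d -> p i = q i) -> Q d p = Q d q.
  by move=> pq; apply: eq_forallb => e; case: (eqVneq e d) => //= /pq ->.
pose jo := Ordinal jn.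
transitivity (\xsum_(d in gtail j) ((\xsum_(p | Q d p && (p d == k :> nat)) G d p)
   (+) (\xsum_(p | Q d p && (p d == 0 :> nat)) G d p))).
  apply: eq_bigr => d dj; rewrite xsum_addb -telescope; last exact: Qinv.
  by congr (_ (+) _); apply: eq_bigl => p; rewrite dj andbT (faceE d).
rewrite (bigD1 jo) ?inE //= [X in _ (+) X]big1 ?addbF; last first.
  move=> d /andP[dj dnj]; have jd : j < d.
    by move: dj dnj; rewrite inE -(inj_eq val_inj) /= ltn_neqAle eq_sym => -> ->.
  have djs : (d : nat) \in js by rewrite mem_iota jd subnKC // ltn_ord.
  rewrite !big1 // => p /andP[_ /eqP pd]; apply/andP => -[_];
    rewrite (@cup_const d js p _ d) ?inE ?eqxx // => q qp.
    by rewrite !f_lo ?qp.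
  by rewrite !f_hi ?qp.
rewrite [X in _ (+) X]big1 ?addbF; last by move=> p /andP[_ /eqP pd]; rewrite /G (f_lo jo).
apply: eq_big => [p|p /andP[_ /eqP pd]]; last first.
  rewrite /G (f_hi jo) //=; congr cup; apply/setP => e.
  by rewrite !inE -(inj_eq val_inj) /= ltn_neqAle eq_sym.
apply/andP/forallP => [[/forallP H pj] e|H].
  move: (H e); rewrite ltnS -(inj_eq val_inj) /= [e <= j]leq_eqVlt; case: eqP => //= ej _.
  by rewrite (_ : e = jo) //; apply/val_inj.
split; last by move: (H jo); rewrite ltnSn.
apply/forallP => e; apply/implyP; rewrite -(inj_eq val_inj) /= => nej.
by move: (H e); rewrite ltnS leq_eqVlt (negPf nej).
Qed.

Lemma grid_change : exists p : pt, (forall i, p i < k) /\ forall j, j < n ->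
  exists q1 q2 : pt, [/\ f j q1, ~~ f j q2,
    forall i, p i <= q1 i <= (p i).+1 & forall i, p i <= q2 i <= (p i).+1].
Proof.
have : gsum 0.
  suff H j : j <= n -> gsum (n - j) by rewrite -(subnn n) H.
  elim: j => [|j IH] jn; first by rewrite subn0 gsum_last.
  by rewrite gsum_step subnSK ?leq_subr ?IH // ltnW.
move=> H.
have [p pf cp] : exists2 p, gface 0 p & cup (iota 0 (n - 0)) p (gtail 0).
  case: (boolP [exists p, gface 0 p && cup (iota 0 (n - 0)) p (gtail 0)]).
    by case/existsP => p /andP[]; exists p.
  rewrite negb_exists => /forallP no; move: H; rewrite /gsum big1 // => p pf.
  by move: (no p); rewrite pf => /negbTE.
have pk i : p i < k by move/forallP: pf => /(_ i).
exists p; split=> // j jn.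
have jin : j \in iota 0 (n - 0) by rewrite mem_iota subn0.
have [q1 [q2 [f1 f2 b1 b2]]] := cup_change _ _ _ _ cp jin (fun d _ => pk d).
by exists q1, q2; split=> // i; [move: (b1 i)|move: (b2 i)]; rewrite inE addn1.
Qed.

End GridCup.

Import Order.TTheory GRing.Theory Num.Theory.
Import numFieldNormedType.Exports.
Local Open Scope classical_set_scope.
Local Open Scope ring_scope.

(** * Brouwer's fixed point theorem *)

Lemma norm_rV_le {R : realType} {n : nat} (x : 'rV[R]_n) (e : R) :
  0 <= e -> (forall i, `|x 0 i| <= e) -> `|x| <= e.
Proof.
move=> e0 xe; rewrite [leLHS]/Num.Def.normr/= mx_normrE (bigmax_le _ e0) //= => -[i j] _.
by rewrite ord1 xe.
Qed.

Lemma coord_norm_le {R : realType} {n : nat} (x : 'rV[R]_n) i : `|x 0 i| <= `|x|.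
Proof. by rewrite [leRHS]/Num.Def.normr/= mx_normrE (le_bigmax _ _ (0, i)). Qed.

Section PointwiseContinuity.
Context {R : realType} {T : topologicalType}.
Implicit Types f g : T -> R.

Lemma contD f g : continuous f -> continuous g -> continuous (fun x => f x + g x).
Proof. by move=> fc gc x; apply: (@cvgD _ R^o); [exact: fc|exact: gc]. Qed.

Lemma contB f g : continuous f -> continuous g -> continuous (fun x => f x - g x).
Proof. by move=> fc gc x; apply: (@cvgB _ R^o); [exact: fc|exact: gc]. Qed.

Lemma contM f g : continuous f -> continuous g -> continuous (fun x => f x * g x).
Proof. by move=> fc gc x; apply: cvgM; [exact: fc|exact: gc]. Qed.

Lemma cont_cst (a : R) : continuous (fun _ : T => a).
Proof. by move=> x; exact: cvg_cst. Qed.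

Lemma cont_rV {n : nat} (f : T -> 'rV[R]_n) :
  (forall i, continuous (fun x => f x 0 i)) -> continuous f.
Proof.
move=> fc x; apply/cvgrPdist_le => e e0; near=> y.
apply: norm_rV_le => [|i]; first exact: ltW.
rewrite !mxE; move: i; near: y; apply: filter_forall => i.
by have /cvgrPdist_le/(_ _ e0) := fc i x.
Unshelve. all: by end_near. Qed.

Lemma cont_coord {n : nat} (f : T -> 'rV[R]_n) i :
  continuous f -> continuous (fun x => f x 0 i).
Proof.
move=> fc x; apply: (@continuous_comp _ _ _ f (fun y : 'rV[R]_n => y 0 i)).
  exact: fc.
exact: coord_continuous.
Qed.

End PointwiseContinuity.

Lemma grid_miranda {R : realType} {n : nat} (F : 'I_n.+1 -> 'rV[R]_n.+1 -> R) (N : nat) :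
  (forall i (x : 'rV[R]_n.+1), (forall j, 0 <= x 0 j <= 1) -> x 0 i = 0 -> F i x <= 0) ->
  (forall i (x : 'rV[R]_n.+1), (forall j, 0 <= x 0 j <= 1) -> x 0 i = 1 -> 0 <= F i x) ->
  exists x : 'rV[R]_n.+1, (forall j, 0 <= x 0 j <= 1) /\
    forall i, exists y z : 'rV[R]_n.+1,
    [/\ `|x - y| <= N.+1%:R^-1, `|x - z| <= N.+1%:R^-1, 0 <= F i y & F i z <= 0].
Proof.
move=> F0 F1; set k := N.+1.
have k0 : 0 < k%:R :> R by rewrite ltr0n.
have kV0 : 0 <= k%:R^-1 :> R by rewrite invr_ge0 ler0n.
pose pt (p : {ffun 'I_n.+1 -> 'I_k.+1}) : 'rV[R]_n.+1 := \row_i ((p i)%:R / k%:R).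
have ptc p j : 0 <= pt p 0 j <= 1.
  by rewrite mxE divr_ge0 ?ler0n //= ler_pdivrMr // mul1r ler_nat -ltnS.
(* The values on the two faces are imposed, because there only weak signs of [F] are given. In all
   cases true still implies [0 <= F] and false implies [F <= 0]. *)
pose f (j : nat) (p : {ffun 'I_n.+1 -> 'I_k.+1}) : bool :=
  ((p (inord j) != 0 :> nat) && ((p (inord j) == k :> nat) || (0 < F (inord j) (pt p)))).
have f_lo (i : 'I_n.+1) (p : {ffun 'I_n.+1 -> 'I_k.+1}) : p i = 0%N :> nat -> f i p = false.
  by rewrite /f inord_val => ->.
have f_hi (i : 'I_n.+1) (p : {ffun 'I_n.+1 -> 'I_k.+1}) : p i = k :> nat -> f i p.
  by rewrite /f inord_val => ->; rewrite eqxx.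
have [p [pk H]] := @grid_change _ _ f f_lo f_hi.
exists (pt p); split=> // i.
have [q1 [q2 [f1 f2 b1 b2]]] := H i (ltn_ord i).
have near (q : {ffun 'I_n.+1 -> 'I_k.+1}) : (forall j, (p j <= q j <= (p j).+1)%N) -> `|pt p - pt q| <= k%:R^-1.
  move=> b; apply: norm_rV_le => // j.
  rewrite !mxE -mulrBl normrM [ `|_^-1|]ger0_norm //.
  rewrite ler_piMl // distrC -natrB; last by case/andP: (b j).
  by rewrite normr_nat lern1 leq_subLR addn1; case/andP: (b j).
exists (pt q1), (pt q2); split; try exact: near.
  move: f1; rewrite /f inord_val => /andP[_ /orP[/eqP qk|/ltW//]].
  by apply: F1 => //; rewrite mxE qk divff // gt_eqF.
move: f2; rewrite /f inord_val negb_and negbK negb_or => /orP[/eqP q0|/andP[_]].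
  by apply: F0 => //; rewrite mxE q0 mul0r.
by rewrite -leNgt.
Qed.

(** A cluster point of the grid solutions for finer and finer meshes is a zero: a strict sign of
    [F i] there would persist on a ball that contains points of both weak signs. *)
Lemma poincare_miranda {R : realType} {n : nat} (F : 'I_n.+1 -> 'rV[R]_n.+1 -> R) :
  (forall i, continuous (F i)) ->
  (forall i (x : 'rV[R]_n.+1), (forall j, 0 <= x 0 j <= 1) -> x 0 i = 0 -> F i x <= 0) ->
  (forall i (x : 'rV[R]_n.+1), (forall j, 0 <= x 0 j <= 1) -> x 0 i = 1 -> 0 <= F i x) ->
  exists x : 'rV[R]_n.+1, (forall j, 0 <= x 0 j <= 1) /\ forall i, F i x = 0.
Proof.
move=> Fc F0 F1.
have [u /all_and2[uc uP]] := choice (fun N => grid_miranda F N F0 F1).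
pose C := [set x : 'rV[R]_n.+1 | forall j, x 0 j \in `[0, 1]].
have Cc : compact C.
  by apply: (@rV_compact R n.+1 (fun=> `[0, 1]%classic)) => _; exact: segment_compact.
have [x [Cx clx]] : C `&` cluster (u @ \oo) !=set0.
  apply: Cc; exists 0%N => // N _ /= j; rewrite in_itv; exact: uc.
exists x; split=> [j|i]; first by move: (Cx j); rewrite in_itv.
have near (e : R) : 0 < e -> exists N, `|x - u N| < e /\ N.+1%:R^-1 < e.
  move=> e0; have [N0 _ HN0] := near_infty_natSinv_lt (PosNum e0).
  have [y [[N NN0 <-] xu]] : (u @` [set N | (N0 <= N)%N]) `&` ball x e !=set0.
    apply: clx; last exact: nbhsx_ballx.
    by exists N0 => // N /= NN; exists N.
  by exists N; split; [move: xu; rewrite -ball_normE | exact: HN0].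
have {}near (e : R) : 0 < e -> exists y z : 'rV[R]_n.+1,
    [/\ `|x - y| < e, `|x - z| < e, 0 <= F i y & F i z <= 0].
  move=> e0; have [N [xN Ne]] := near (e / 2) (divr_gt0 e0 (ltr0n _ 2)).
  have [y [z [uy uz Fy Fz]]] := uP N i.
  exists y, z; split=> //; rewrite [e]splitr -(subrKA (u N)) (le_lt_trans (ler_normD _ _)) //;
    by rewrite ltrD // (le_lt_trans _ Ne).
apply/eqP; rewrite eq_le; apply/andP; split; rewrite leNgt; apply/negP => Fx.
  have /nbhs_ballP[e e0 He] : \forall y \near x, 0 < F i y.
    exact: (@cvgr_gt _ _ _ _ _ (F i x) (Fc i x)).
  have [y [z [_ xz _]]] := near e e0.
  by apply/negP; rewrite -ltNge; apply: He; rewrite -ball_normE.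
have /nbhs_ballP[e e0 He] : \forall y \near x, F i y < 0.
  exact: (@cvgr_lt _ _ _ _ _ (F i x) (Fc i x)).
have [y [z [xy _ + _]]] := near e e0.
by apply/negP; rewrite -ltNge; apply: He; rewrite -ball_normE.
Qed.

(** Poincare-Miranda is applied to [x - G x], the unit cube being rescaled to the cube of radius
    [r]. *)
Lemma brouwer_cube {R : realType} {n : nat} (r : R) (G : 'rV[R]_n.+1 -> 'rV[R]_n.+1) :
  0 < r -> continuous G ->
  (forall x : 'rV[R]_n.+1, (forall j, `|x 0 j| <= r) -> forall j, `|G x 0 j| <= r) ->
  exists x : 'rV[R]_n.+1, (forall j, `|x 0 j| <= r) /\ G x = x.
Proof.
move=> r0 Gc Gr.
pose s (y : 'rV[R]_n.+1) : 'rV[R]_n.+1 := (2 * r) *: y - const_mx r.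
have sE y j : s y 0 j = 2 * r * y 0 j - r by rewrite !mxE.
have sc : continuous s.
  apply: cont_rV => j; rewrite (_ : (fun x => s x 0 j) = fun x => 2 * r * x 0 j - r); last first.
    by apply/funext => x; rewrite sE.
  by apply: contB (cont_cst _); apply: contM (cont_cst _) _; exact: coord_continuous.
have sr (y : 'rV[R]_n.+1) : (forall j, 0 <= y 0 j <= 1) -> forall j, `|s y 0 j| <= r.
  by move=> y01 j; rewrite sE ler_norml; move: (y01 j) => /andP[? ?]; nra.
pose F (i : 'I_n.+1) (y : 'rV[R]_n.+1) : R := s y 0 i - G (s y) 0 i.
have Fc i : continuous (F i).
  apply: contB; apply: cont_coord => //.
  by move=> y; apply: continuous_comp; [exact: sc|exact: Gc].
have [i y y01 yi|i y y01 yi|y [y01 Fy]] := poincare_miranda F Fc.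
- by have := Gr _ (sr _ y01) i; rewrite /F sE yi ler_norml; lra.
- by have := Gr _ (sr _ y01) i; rewrite /F sE yi ler_norml; lra.
exists (s y); split; first exact: sr.
by apply/rowP => j; move/eqP: (Fy j); rewrite subr_eq0 => /eqP.
Qed.

(** * One-variable calculus *)

Section PointwiseDerivative.
Context {R : realType}.
Implicit Types f g : R -> R.

Lemma derD {f g} {t a b : R} : is_derive t 1 f a -> is_derive t 1 g b ->
  is_derive t 1 (fun s => f s + g s) (a + b).
Proof. by move=> fa gb; exact: (is_deriveD fa gb). Qed.

Lemma derB {f g} {t a b : R} : is_derive t 1 f a -> is_derive t 1 g b ->
  is_derive t 1 (fun s => f s - g s) (a - b).
Proof. by move=> fa gb; exact: (is_deriveB fa gb). Qed.

Lemma derM {f g} {t a b : R} : is_derive t 1 f a -> is_derive t 1 g b ->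
  is_derive t 1 (fun s => f s * g s) (a * g t + f t * b).
Proof.
move=> fa gb; apply: (@is_derive_eq _ _ _ _ _ _ _ _ (is_deriveM fa gb)).
by rewrite addrC mulrC.
Qed.

Lemma der_cst (a t : R) : is_derive t 1 (fun _ : R => a) 0.
Proof. exact: is_derive_cst. Qed.

Lemma der_id (t : R) : is_derive t 1 (fun s : R => s) 1.
Proof. exact: is_derive_id. Qed.

Lemma der_sum {n : nat} {f : 'I_n -> R -> R} {d : 'I_n -> R} {t : R} :
  (forall i, is_derive t 1 (f i) (d i)) ->
  is_derive t 1 (fun s => \sum_i f i s) (\sum_i d i).
Proof.
move=> fd; rewrite (_ : (fun s => _) = \sum_i f i); first exact: is_derive_sum.
by apply/funext => s; rewrite fct_sumE.
Qed.

Lemma der_eqf {f g} {t a : R} : is_derive t 1 f a -> f =1 g -> is_derive t 1 g a.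
Proof. by move=> fa /funext <-. Qed.

Lemma der_eqd {f} {t a b : R} : is_derive t 1 f a -> a = b -> is_derive t 1 f b.
Proof. by move=> fa <-. Qed.

Lemma der_continuous_at {f} {t a : R} : is_derive t 1 f a -> {for t, continuous f}.
Proof. by move=> [dft _]; exact/differentiable_continuous/derivable1_diffP. Qed.

Lemma der_comp {f g} {t a b : R} : is_derive (g t) 1 f a -> is_derive t 1 g b ->
  is_derive t 1 (fun s => f (g s)) (a * b).
Proof. by move=> fa gb; exact: (is_derive1_comp fa gb). Qed.

Lemma der_shift {f} {t c a : R} :
  is_derive (t + c) 1 f a -> is_derive t 1 (fun s => f (s + c)) a.
Proof.
move=> fa; have := der_comp (g := fun s => s + c) fa (derD (der_id t) (der_cst c t)).
by rewrite addr0 mulr1.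
Qed.

Lemma der_opp {f} {t a : R} :
  is_derive (- t) 1 f a -> is_derive t 1 (fun s => f (- s)) (- a).
Proof.
rewrite -[- t]sub0r => fa.
have := der_comp (g := fun s => 0 - s) fa (derB (der_cst 0 t) (der_id t)).
by rewrite sub0r mulrN1 => /der_eqf; apply => s; rewrite sub0r.
Qed.

Lemma der_expR (c t : R) : is_derive t 1 (fun s => expR (c * s)) (c * expR (c * t)).
Proof.
have := der_comp (g := fun s => c * s) (is_derive_expR (c * t)) (derM (der_cst c t) (der_id t)).
by rewrite mul0r add0r mulr1 mulrC.
Qed.

Lemma der_uniq {f} {t a b : R} : is_derive t 1 f a -> is_derive t 1 f b -> a = b.
Proof. by move=> [_ <-] [_ <-]. Qed.

Lemma der_mean f (df : R -> R) (a b : R) : a < b ->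
  (forall t, a <= t <= b -> is_derive t 1 f (df t)) ->
  exists2 c, a < c < b & f b - f a = df c * (b - a).
Proof.
move=> ab fd; have [||c cab fE] := @MVT R f df a b ab.
- by move=> x; rewrite in_itv => /andP[/ltW ax /ltW xb]; apply: fd; rewrite ax.
- apply/continuous_in_subspaceT => x; rewrite inE /= in_itv => /fd.
  exact: der_continuous_at.
by exists c.
Qed.

Lemma der_ndecr f (df : R -> R) (a b : R) : a <= b ->
  (forall t, a <= t <= b -> is_derive t 1 f (df t)) ->
  (forall t, a <= t <= b -> 0 <= df t) -> f a <= f b.
Proof.
rewrite le_eqVlt => /predU1P[-> //|ab fd d0].
have [c /andP[/ltW ac /ltW cb] fE] := der_mean _ _ _ _ ab fd.
by rewrite -subr_ge0 fE mulr_ge0 // ?d0 ?ac // subr_ge0 ltW.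
Qed.

Lemma der0_const f (a b : R) : a <= b ->
  (forall t, a <= t <= b -> is_derive t 1 f 0) -> f a = f b.
Proof.
rewrite le_eqVlt => /predU1P[-> //|ab fd].
have [c _] := der_mean _ (fun=> 0) _ _ ab fd.
by rewrite mul0r => /eqP; rewrite subr_eq0 => /eqP.
Qed.

Lemma der_le f g (df dg : R -> R) (a b : R) : a <= b ->
  (forall t, a <= t <= b -> is_derive t 1 f (df t)) ->
  (forall t, a <= t <= b -> is_derive t 1 g (dg t)) ->
  (forall t, a <= t <= b -> df t <= dg t) -> f b - f a <= g b - g a.
Proof.
move=> ab fd gd dle; suff : g a - f a <= g b - f b by lra.
apply: (der_ndecr (fun t => g t - f t) (fun t => dg t - df t)) => // t tab.
  by apply: derB; [exact: gd|exact: fd].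
by rewrite subr_ge0 dle.
Qed.

Lemma der_neg {f} {t a : R} : is_derive t 1 f a -> a < 0 ->
  exists2 e : R, 0 < e & forall s, `|t - s| < e ->
    exists2 h, h < 0 & f s - f t = h * (s - t).
Proof.
move=> /is_derive1_caratheodory[h [hE hc ht]] a0.
have /nbhs_ballP[e e0 He] : \forall s \near t, h s < 0.
  by apply: (@cvgr_lt _ _ _ _ _ (h t) hc); rewrite ht.
exists e => // s ts; exists (h s) => //.
by apply: He; rewrite -ball_normE.
Qed.

(** The supremum [s] of the times with [f <= c] satisfies [f s <= c]; if [s < b], either continuity
    or the negative derivative keeps [f <= c] a little beyond [s]. *)
Lemma der_barrier f (df : R -> R) (c a b : R) : a <= b -> f a <= c ->
  (forall t, a <= t <= b -> is_derive t 1 f (df t)) ->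
  (forall t, a <= t <= b -> f t = c -> df t < 0) -> f b <= c.
Proof.
move=> ab fac fd d0; rewrite leNgt; apply/negP => cfb.
pose S := [set t | a <= t <= b /\ f t <= c].
have Sa : S a by split=> //; rewrite lexx.
have Sb : ubound S b by move=> t [/andP[]].
have hS : has_sup S by split; [exists a|exists b].
set s := sup S.
have as_ : a <= s by exact: sup_upper_bound.
have sb : s <= b by exact: (ge_sup (ex_intro _ a Sa)).
have sab : a <= s <= b by rewrite as_ sb.
have sd := fd s sab.
have sc := der_continuous_at sd.
have fsc : f s <= c.
  rewrite leNgt; apply/negP => cfs.
  have /nbhs_ballP[e e0 He] : \forall y \near s, c < f y by exact: (@cvgr_gt _ _ _ _ _ (f s) sc).
  have [y [yab fy] ys] := sup_adherent e0 hS.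
  have : c < f y.
    apply: He; rewrite -ball_normE /ball_ /= ger0_norm ?subr_ge0 ?sup_upper_bound //.
    by rewrite -/s in ys; lra.
  by rewrite ltNge fy.
have slb : s < b by rewrite lt_neqAle sb andbT; apply: contraTneq cfb => <-; rewrite -leNgt.
have [e e0 He] : exists2 e, 0 < e & forall y, s < y -> y < s + e -> f y <= c.
  move: fsc; rewrite le_eqVlt => /predU1P[fsc|fsc].
    have [e e0 He] := der_neg sd (d0 s sab fsc); exists e => // y sy ye.
    have [|h h0 hE] := He y; first by rewrite distrC gtr0_norm ?subr_gt0 //; lra.
    by rewrite -fsc -subr_le0 hE; nra.
  have /nbhs_ballP[e e0 He] : \forall y \near s, f y < c by exact: (@cvgr_lt _ _ _ _ _ (f s) sc).
  exists e => // y sy ye; apply/ltW/He; rewrite -ball_normE /ball_ /= distrC.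
  by rewrite gtr0_norm ?subr_gt0 //; lra.
pose y := s + Num.min (e / 2) (b - s).
have y1 : Num.min (e / 2) (b - s) <= e / 2 by rewrite ge_min lexx.
have y2 : Num.min (e / 2) (b - s) <= b - s by rewrite ge_min lexx orbT.
have y3 : 0 < Num.min (e / 2) (b - s) by rewrite lt_min subr_gt0 slb andbT; lra.
have : y <= s.
  apply: sup_upper_bound => //; split; first by rewrite /y; lra.
  by apply: He; rewrite /y; lra.
by rewrite /y; lra.
Qed.

Lemma der_min f (df : R -> R) (t : R) : (forall s : R, is_derive s 1 f (df s)) ->
  (forall s, f t <= f s) -> df t = 0.
Proof.
move=> fd fm; apply: (der_uniq (fd t)).
apply: (@derive1_at_min _ f (t - 1) (t + 1)) => //; first lra.
by rewrite in_itv /=; apply/andP; split; lra.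
Qed.

(** As [df t = 0], a negative derivative of [df] would make [df] negative just after [t], and [f]
    would fall below its minimum. *)
Lemma der_min2 f (df : R -> R) (t a : R) : (forall s : R, is_derive s 1 f (df s)) ->
  (forall s, f t <= f s) -> is_derive t 1 df a -> 0 <= a.
Proof.
move=> fd fm da; rewrite leNgt; apply/negP => a0.
have [e e0 He] := der_neg da a0.
have [c] := der_mean f df t (t + e / 2) ltac:(lra) (fun s _ => fd s).
move=> tc fE; have [|h h0] := He c; first by rewrite distrC gtr0_norm; lra.
rewrite (der_min f df t fd fm) => hE; have := fm (t + e / 2).
have : df c < 0 by nra.
by move: fE; nra.
Qed.

End PointwiseDerivative.

Section Antiderivative.
Context {R : realType}.
Notation mu := (@lebesgue_measure R).

Let prim (f : R -> R) (a x : R) : R := (\int[mu]_(t in [set` `[a, x]]) f t)%R.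

Let prim_der (f : R -> R) (a x : R) : continuous f -> a < x -> is_derive x 1 (prim f a) (f x).
Proof.
move=> fc ax; have [||d dE] := @continuous_FTC1_closed R f a x (x + 1) _ _ ax (fc x).
- by rewrite ltrDl.
- apply: continuous_compact_integrable; first exact: segment_compact.
  exact: continuous_subspaceT.
- by rewrite -dE derive1E; exact: derivableP.
Qed.

Let prim_eq (f : R -> R) (a b x : R) : continuous f -> a < 0 -> b < 0 -> a < x -> b < x ->
  prim f a x - prim f a 0 = prim f b x - prim f b 0.
Proof.
move=> fc a0 b0 ax bx.
pose h t := prim f a t - prim f b t.
have hd t : a < t -> b < t -> is_derive t 1 h 0.
  by move=> at_ bt; rewrite -(subrr (f t)); apply: derB; exact: prim_der.
have hle u v : a < u -> b < u -> u <= v -> h u = h v.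
  move=> au bu uv; apply: der0_const => // t /andP[ut _].
  by apply: hd; exact: lt_le_trans ut.
suff : h x = h 0.
  by rewrite /h; move: (prim f a x) (prim f b x) (prim f a 0) (prim f b 0) => *; lra.
by case: (leP x 0) => [|/ltW] /hle; [|move=> <-]; exact.
Qed.

Lemma antiderivative (f : R -> R) : continuous f ->
  exists F : R -> R, F 0 = 0 /\ forall t : R, is_derive t 1 F (f t).
Proof.
(* The base point must lie to the left of both 0 and [x], since an integral over an empty interval
   is 0; hence it moves with [x], and [prim_eq] shows that its choice does not matter. *)
move=> fc; pose F x := prim f (- `|x| - 1) x - prim f (- `|x| - 1) 0.
exists F; split=> [|t]; first by rewrite /F subrr.
(* The base point [- |t| - 2] lies to the left of every point within distance 1 of [t], so a single
   primitive serves near [t]. *)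
have := derB (prim_der f (- `|t| - 2) t fc _) (der_cst (prim f (- `|t| - 2) 0) t).
rewrite subr0 => H; apply: near_eq_is_derive (H _); last first.
  by have := ler_norm (- t); rewrite normrN; lra.
exists 1 => //= s; rewrite /ball_ /= => ts.
have nst : `|s| <= `|t| + 1.
  by rewrite -[s](subrK t) (le_trans (ler_normD _ _)) // addrC lerD2l distrC ltW.
have hs := ler_norm (- s); have ht := normr_ge0 t; rewrite normrN in hs.
have hs0 := normr_ge0 s.
by rewrite /F; apply: prim_eq => //; lra.
Qed.

End Antiderivative.

(** * Flows of globally Lipschitz fields *)

Lemma exp_half_small {R : realType} (c e : R) : 0 <= c -> 0 < e ->
  exists k, forall m, (k <= m)%N -> c / 2 ^+ m < e.
Proof.
move=> c0 e0; have [k _ Hk] := near_infty_natSinv_lt (PosNum (divr_gt0 e0 (ltr_wpDl c0 ltr01))).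
exists k => m km; rewrite ltr_pdivrMr ?exprn_gt0 //.
have := Hk m km; rewrite /= => H.
have m1 : m.+1%:R <= 2 ^+ m :> R by rewrite -natrX ler_nat ltn_expl.
have m0 : 0 < m.+1%:R :> R by rewrite ltr0n.
have c1 : 0 < c + 1 by rewrite ltr_wpDl.
have : c + 1 < e * m.+1%:R by rewrite -ltr_pdivrMr // mulrC -ltr_pdivlMr.
by nra.
Qed.

Lemma rVB {R : realType} {n : nat} (x y : 'rV[R]_n) i : (x - y) 0 i = x 0 i - y 0 i.
Proof. by rewrite !mxE. Qed.

Section ExponentialComparison.
Context {R : realType}.

Lemma exp_compare (u du : R -> R) (K a : R) : 0 <= K -> u 0 = 0 ->
  (forall t : R, is_derive t 1 u (du t)) ->
  (forall t, `|du t| <= K * a * expR (a * `|t|)) ->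
  forall t, `|u t| <= K * expR (a * `|t|).
Proof.
move=> K0; wlog suff pos : u du / forall t, 0 <= t -> u 0 = 0 ->
  (forall t : R, is_derive t 1 u (du t)) ->
  (forall t, `|du t| <= K * a * expR (a * `|t|)) -> `|u t| <= K * expR (a * `|t|).
  move=> u0 ud dub t; have [t0|/ltW t0] := leP 0 t; first exact: (pos u du).
  have := pos (fun s => u (- s)) (fun s => - du (- s)) (- t).
  rewrite !normrN oppr_ge0 t0 oppr0 opprK; apply=> // s; first exact: der_opp.
  by rewrite normrN; have := dub (- s); rewrite normrN.
move=> t t0 u0 ud dub; rewrite [`|t|]ger0_norm //.
have gd (s : R) : is_derive s 1 (fun s => K * expR (a * s)) (K * a * expR (a * s)).
  have := derM (der_cst K s) (der_expR a s).
  by rewrite mul0r add0r mulrA.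
have Ke : 0 <= K * expR (a * 0) by rewrite mulr_ge0 // expR_ge0.
have up : u t - u 0 <= K * expR (a * t) - K * expR (a * 0).
  apply: (der_le _ _ du _ _ _ t0 (fun s _ => ud s) (fun s _ => gd s)) => s /andP[s0 _].
  by have := dub s; rewrite [`|s|]ger0_norm //; have := ler_norm (du s); lra.
have dn : (0 - u t) - (0 - u 0) <= K * expR (a * t) - K * expR (a * 0).
  apply: (der_le (fun s => 0 - u s) _ (fun s => 0 - du s) _ _ _ t0
    (fun s _ => derB (der_cst 0 s) (ud s)) (fun s _ => gd s)).
  move=> s /andP[s0 _].
  by have := dub s; rewrite [`|s|]ger0_norm //; have := ler_norm (- du s); rewrite normrN; lra.
by rewrite ler_norml u0 in up dn *; lra.
Qed.

End ExponentialComparison.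

Section GlobalFlow.
Context {R : realType} {n : nat}.
Variables (f : R -> 'rV[R]_n -> 'rV[R]_n) (L M : R).
Hypothesis L_gt0 : 0 < L.
Hypothesis f_cont : forall x i, continuous (fun t => f t x 0 i).
Hypothesis f_lip : forall t x y, `|f t x - f t y| <= L * `|x - y|.
Hypothesis f_bnd : forall t, `|f t 0| <= M.

Definition solves (y : R -> 'rV[R]_n) :=
  forall (t : R) i, is_derive t 1 (fun s => y s 0 i) (f t (y t) 0 i).

Let f_along (y : R -> 'rV[R]_n) i : continuous y -> continuous (fun t => f t (y t) 0 i).
Proof.
move=> yc t; apply/cvgrPdist_le => e e0.
have e2 : 0 < e / 2 by rewrite divr_gt0.
have e3 : 0 < e / 2 / L by rewrite divr_gt0.
near=> s.
rewrite -[f t _ _ _](subrK (f s (y t) 0 i)) -addrA (splitr e) (le_trans (ler_normD _ _)) // lerD //.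
  near: s; move: (f_cont (y t) i t); move/cvgrPdist_le => /(_ _ e2); exact.
rewrite -rVB (le_trans (coord_norm_le _ _)) // (le_trans (f_lip _ _ _)) // mulrC -ler_pdivlMr //.
by near: s; have /cvgrPdist_le/(_ _ e3) := yc t.
Unshelve. all: by end_near. Qed.

Let prim (g : R -> R) : R -> R :=
  if pselect (continuous g) is left gc then projT1 (cid (antiderivative g gc)) else fun=> 0.

Let primP (g : R -> R) : continuous g -> prim g 0 = 0 /\ forall t : R, is_derive t 1 (prim g) (g t).
Proof. by rewrite /prim; case: pselect => // gc _; case: cid. Qed.

Implicit Types (x : 'rV[R]_n) (y z : R -> 'rV[R]_n) (t K : R).

Let picard x y t : 'rV[R]_n :=
  \row_i (x 0 i + prim (fun s => f s (y s) 0 i) t).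

Let picard_der x y t i : continuous y ->
  is_derive t 1 (fun s => picard x y s 0 i) (f t (y t) 0 i).
Proof.
move=> yc; have [_ /(_ t) pd] := primP _ (f_along y i yc).
by have := derD (der_cst (x 0 i) t) pd; rewrite add0r => /der_eqf; apply => s; rewrite mxE.
Qed.

Let picard_cont x y : continuous y -> continuous (picard x y).
Proof. by move=> yc; apply: cont_rV => i t; exact: der_continuous_at (picard_der x y t i yc). Qed.

Let picard0 x y : continuous y -> picard x y 0 = x.
Proof.
move=> yc; apply/rowP => i; rewrite mxE; have [-> _] := primP _ (f_along y i yc).
by rewrite addr0.
Qed.

(** In the norm weighted by [exp (- 2 L |t|)] (Bielecki's), integration gains a factor [1 / (2 L)],
    so the Picard map contracts by 1/2 on the whole line at once. *)
Let picard_contract x y z K : continuous y -> continuous z -> 0 <= K ->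
  (forall t, `|y t - z t| <= K * expR (2 * L * `|t|)) ->
  forall t, `|picard x y t - picard x z t| <= K / 2 * expR (2 * L * `|t|).
Proof.
move=> yc zc K0 yz t; apply: norm_rV_le => [|i].
  by rewrite mulr_ge0 ?divr_ge0 // expR_ge0.
rewrite rVB.
apply: (exp_compare (fun s => picard x y s 0 i - picard x z s 0 i)
         (fun s => f s (y s) 0 i - f s (z s) 0 i)).
- by rewrite divr_ge0.
- by rewrite !picard0 // subrr.
- by move=> s; exact: (derB (picard_der x y s i yc) (picard_der x z s i zc)).
move=> s; rewrite -rVB (le_trans (coord_norm_le _ _)) // (le_trans (f_lip _ _ _)) //.
apply: (le_trans (ler_wpM2l (ltW L_gt0) (yz s))).
rewrite le_eqVlt; apply/orP; left; apply/eqP; by field.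
Qed.

Let iter x k := iter k (picard x) (fun=> x).

Let iter_cont x k : continuous (iter x k).
Proof. by elim: k => [|k IH]; [move=> t; exact: cvg_cst|exact: picard_cont]. Qed.

(** [2 L * rate x = M + L |x|] bounds the field along the constant curve [x]; thus [rate x] bounds
    the first Picard step in the weighted norm. *)
Let rate x : R := (M + L * `|x|) / (2 * L).

Let rate_ge0 x : 0 <= rate x.
Proof.
have M0 : 0 <= M := le_trans (normr_ge0 _) (f_bnd 0).
by rewrite divr_ge0 ?addr_ge0 ?mulr_ge0 // ltW.
Qed.

Let tail_ge0 x k : 0 <= 2 * rate x / 2 ^+ k.
Proof. by apply: divr_ge0; [apply: mulr_ge0 => //|apply: exprn_ge0]. Qed.

Let iter_step x k t : `|iter x k.+1 t - iter x k t| <= rate x / 2 ^+ k * expR (2 * L * `|t|).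
Proof.
elim: k t => [|k IH] t; last first.
  rewrite exprSr invfM mulrA; apply: (picard_contract _ _ _ _ (iter_cont x k.+1) (iter_cont x k) _ IH).
  by rewrite divr_ge0 // exprn_ge0.
rewrite expr0 divr1; apply: norm_rV_le => [|i]; first by rewrite mulr_ge0 // expR_ge0.
rewrite rVB.
have xc : continuous ((fun=> x) : R -> 'rV[R]_n) by move=> s; exact: cvg_cst.
apply: (exp_compare (fun s => picard x (fun=> x) s 0 i - x 0 i) (fun s => f s x 0 i - 0)) => //.
- by rewrite picard0 // subrr.
- by move=> s; exact: (derB (picard_der x _ s i xc) (der_cst (x 0 i) s)).
move=> s; rewrite subr0 (le_trans (coord_norm_le _ _)) //.
rewrite -[f s x](subrK (f s 0)) (le_trans (ler_normD _ _)) //.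
have := f_lip s x 0; rewrite subr0; have := f_bnd s.
rewrite /rate divfK; last by rewrite mulf_neq0 // gt_eqF.
have := expR_ge1Dx (2 * L * `|s|).
have : 0 <= 2 * L * `|s| by rewrite !mulr_ge0 // ltW.
have := normr_ge0 (f s 0); have := mulr_ge0 (ltW L_gt0) (normr_ge0 x); nra.
Qed.

Let iter_cauchy x k m t : (k <= m)%N ->
  `|iter x m t - iter x k t| <= 2 * rate x / 2 ^+ k * expR (2 * L * `|t|).
Proof.
move=> /subnK <-; set j := (m - k)%N.
(* The geometric sum is kept in telescoped form, so that the bound is stable under the induction on
   [j]. *)
suff : `|iter x (j + k) t - iter x k t| <=
   (2 * rate x / 2 ^+ k - 2 * rate x / 2 ^+ (j + k)) * expR (2 * L * `|t|).
  move/le_trans; apply; rewrite ler_wpM2r ?expR_ge0 // gerBl tail_ge0 //.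
elim: j => [|j IH]; first by rewrite add0n !subrr mul0r normr0.
rewrite -[iter x (j.+1 + k) t](subrK (iter x (j + k) t)) -addrA (le_trans (ler_normD _ _)) //.
have := iter_step x (j + k) t; rewrite addSn => H.
apply: (le_trans (lerD H IH)); rewrite -mulrDl ler_wpM2r ?expR_ge0 //.
rewrite [2 ^+ (j + k).+1]exprSr invfM.
have : 2 != 0 :> R by rewrite pnatr_eq0.
set q := (2 ^+ (j + k))^-1; move=> ?; rewrite (_ : 2 * rate x * (q / 2) = rate x * q); last by field.
lra.
Qed.

Let flow x t : 'rV[R]_n := \row_i lim ((fun k => iter x k t 0 i) @ \oo).

Let flow_close x k t : `|flow x t - iter x k t| <= 2 * rate x / 2 ^+ k * expR (2 * L * `|t|).
Proof.
have e0 : 0 <= 2 * rate x * expR (2 * L * `|t|) by rewrite mulr_ge0 ?expR_ge0 // mulr_ge0.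
apply: norm_rV_le => [|i]; first by rewrite mulr_ge0 // expR_ge0.
rewrite rVB mxE.
have cvgi : cvg ((fun k => iter x k t 0 i) @ \oo).
  apply: cauchy_cvg; apply: cauchy_exP => e epos.
  have [N HN] := exp_half_small _ _ e0 epos.
  exists (iter x N t 0 i), N => // m /= Nm; rewrite -ball_normE /ball_ /= distrC.
  apply: le_lt_trans (HN N (leqnn N)).
  by rewrite -rVB (le_trans (coord_norm_le _ _)) // (le_trans (iter_cauchy x N m t Nm)) // mulrAC.
apply/ler_addgt0Pr => e epos.
have /cvgrPdist_le/(_ e epos)[N _ HN] := cvgi.
pose m := maxn N k.
rewrite -[lim _](subrK (iter x m t 0 i)) -addrA (le_trans (ler_normD _ _)) // [leRHS]addrC lerD //.
  by apply: HN; rewrite /= leq_maxl.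
by rewrite -rVB (le_trans (coord_norm_le _ _)) // iter_cauchy // leq_maxr.
Qed.

(** The iterates converge locally uniformly: for [|s| <= |t| + 1] the weight is at most its value at
    [|t| + 1]. *)
Let flow_cont x : continuous (flow x).
Proof.
move=> t; apply/cvgrPdist_le => e e0.
have e3 : 0 < e / 3 by rewrite divr_gt0.
have E0 : 0 <= 2 * rate x * expR (2 * L * (`|t| + 1)) by rewrite mulr_ge0 ?expR_ge0 // mulr_ge0.
have [k /(_ k (leqnn k)) Hk] := exp_half_small _ _ E0 e3.
have close s : `|s| <= `|t| + 1 -> `|flow x s - iter x k s| <= e / 3.
  move=> st; rewrite (le_trans (flow_close x k s)) // ltW // (le_lt_trans _ Hk) //.
  by rewrite [leRHS]mulrAC ler_wpM2l // ler_expR ler_pM2l // mulr_gt0.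
have ct := close t ltac:(by rewrite lerDl).
near=> s.
have d1 : `|t - s| < 1 by near: s; exists 1 => //=.
have st : `|s| <= `|t| + 1.
  rewrite -[s](subrK t) (le_trans (ler_normD _ _)) // addrC lerD2l distrC ltW //.
have cs := close s st.
have ks : `|iter x k t - iter x k s| <= e / 3.
  by near: s; have /cvgrPdist_le/(_ _ e3) := iter_cont x k t.
have -> : flow x t - flow x s = (flow x t - iter x k t) +
    ((iter x k t - iter x k s) - (flow x s - iter x k s)).
  by rewrite opprB addrA subrKA subrKA.
rewrite (le_trans (ler_normD _ _)) // (_ : e = e / 3 + (e / 3 + e / 3)); last by field.
by rewrite lerD // (le_trans (ler_normB _ _)) // lerD.
Unshelve. all: by end_near. Qed.

Let flow_fix x t : flow x t = picard x (flow x) t.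
Proof.
apply/eqP; rewrite -subr_eq0 -normr_le0; apply/ler_addgt0Pr => e e0; rewrite add0r.
have E0 : 0 <= 2 * rate x * expR (2 * L * `|t|) by rewrite mulr_ge0 ?expR_ge0 // mulr_ge0.
have e2 : 0 < e / 2 by rewrite divr_gt0.
have [k Hk] := exp_half_small _ _ E0 e2.
have c1 : `|flow x t - iter x k.+1 t| <= e / 2.
  by rewrite (le_trans (flow_close x k.+1 t)) // mulrAC ltW // Hk.
have c2 : `|picard x (iter x k) t - picard x (flow x) t| <= e / 2.
  have H s : `|iter x k s - flow x s| <= 2 * rate x / 2 ^+ k * expR (2 * L * `|s|).
    by rewrite distrC; exact: flow_close.
  apply: (le_trans (picard_contract x _ _ _ (iter_cont x k) (flow_cont x) (tail_ge0 x k) H t)).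
  rewrite -[_ / 2]mulrA -invfM -exprSr mulrAC ltW // Hk //.
rewrite -[flow x t](subrK (iter x k.+1 t)) -addrA (le_trans (ler_normD _ _)) //.
by rewrite [e]splitr; exact: (lerD c1 c2).
Qed.

Lemma sqr_norm_le_sum x : `|x| ^+ 2 <= \sum_i x 0 i ^+ 2.
Proof.
rewrite -ler_sqrt ?sumr_ge0 ?sqrtr_sqr ?normr_id //; last by move=> i _; exact: sqr_ge0.
apply: norm_rV_le => [|i]; first exact: sqrtr_ge0.
rewrite -sqrtr_sqr ler_wsqrtr // (bigD1 i) //= lerDl sumr_ge0 // => j _.
exact: sqr_ge0.
Qed.

(** The sup norm is not differentiable, so the estimate runs through the Euclidean square [E];
    comparing the two norms costs the factors [n] in front and in the exponent. *)
Lemma solves_gronwall y z t : solves y -> solves z ->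
  `|y t - z t| ^+ 2 <= n%:R * `|y 0 - z 0| ^+ 2 * expR (2 * L * n%:R * `|t|).
Proof.
move=> ys zs.
pose u i s := y s 0 i - z s 0 i.
pose du i s := f s (y s) 0 i - f s (z s) 0 i.
have ud i (s : R) : is_derive s 1 (u i) (du i s) by exact: (derB (ys s i) (zs s i)).
pose E s := \sum_i u i s * u i s.
pose dE s := \sum_i (du i s * u i s + u i s * du i s).
have Ed (s : R) : is_derive s 1 E (dE s) by apply: der_sum => i; exact: derM.
pose a := 2 * L * n%:R.
have yzE s : `|y s - z s| ^+ 2 <= E s.
  rewrite (le_trans (sqr_norm_le_sum _)) // le_eqVlt; apply/orP; left; apply/eqP.
  by apply: eq_bigr => i _; rewrite rVB expr2.
have E0 s : 0 <= E s by exact: le_trans (sqr_ge0 _) (yzE s).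
have dEb s : `|dE s| <= a * E s.
  apply: (le_trans (ler_norm_sum _ _ _)).
  apply: (@le_trans _ _ (\sum_(i < n) 2 * L * E s)); last first.
    by rewrite sumr_const card_ord -mulr_natr /a; lra.
  apply: ler_sum => i _.
  have -> : du i s * u i s + u i s * du i s = 2 * (du i s * u i s) by ring.
  rewrite normrM normr_nat -mulrA ler_pM2l // normrM.
  have dub : `|du i s| <= L * `|y s - z s|.
    by rewrite /du -rVB (le_trans (coord_norm_le _ _)).
  have ub : `|u i s| <= `|y s - z s| by rewrite /u -rVB coord_norm_le.
  apply: (le_trans (ler_pM (normr_ge0 _) (normr_ge0 _) dub ub)).
  by rewrite -mulrA -expr2 ler_pM2l.
have En : E 0 <= n%:R * `|y 0 - z 0| ^+ 2.
  apply: (@le_trans _ _ (\sum_(i < n) `|y 0 - z 0| ^+ 2)); last first.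
    by rewrite sumr_const card_ord mulr_natl.
  apply: ler_sum => i _; rewrite -expr2 -[leLHS]real_normK ?num_real //.
  by rewrite ler_sqr ?nnegrE // /u -rVB coord_norm_le.
apply: (le_trans (yzE t)); apply: (@le_trans _ _ (E 0 * expR (a * `|t|))); last first.
  by rewrite ler_wpM2r ?expR_ge0.
have [t0|/ltW t0] := leP 0 t.
  rewrite ger0_norm //.
  have Gd (s : R) := derM (Ed s) (der_expR (- a) s).
  have : (0 - E 0 * expR (- a * 0)) <= 0 - E t * expR (- a * t).
    apply: (der_ndecr _ _ _ _ t0 (fun s _ => derB (der_cst 0 s) (Gd s))) => s _.
    have := dEb s; have := ler_norm (dE s); have := expR_gt0 (- a * s) => ? ? ?.
    rewrite (_ : _ - _ = (a * E s - dE s) * expR (- a * s)); last by ring.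
    by apply: mulr_ge0; [lra|exact: ltW].
  rewrite mulr0 expR0 mulr1 mulNr expRN !sub0r lerN2.
  by rewrite ler_pdivrMr ?expR_gt0.
rewrite ler0_norm //.
have Gd (s : R) := derM (Ed s) (der_expR a s).
have : E t * expR (a * t) <= E 0 * expR (a * 0).
  apply: (der_ndecr _ _ _ _ t0 (fun s _ => Gd s)) => s _.
  have := dEb s; have := ler_norm (- dE s); rewrite normrN; have := expR_gt0 (a * s) => ? ? ?.
  rewrite (_ : _ + _ = (a * E s + dE s) * expR (a * s)); last by ring.
  by apply: mulr_ge0; [lra|exact: ltW].
by rewrite mulr0 expR0 mulr1 mulrN expRN ler_pdivlMr ?expR_gt0.
Qed.

Lemma solves_uniq y z : solves y -> solves z -> y 0 = z 0 -> y =1 z.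
Proof.
move=> ys zs yz0 t; apply/eqP; rewrite -subr_eq0 -normr_eq0 -sqrf_eq0 eq_le sqr_ge0 andbT.
by have := solves_gronwall y z t ys zs; rewrite yz0 subrr normr0 expr0n mulr0 mul0r.
Qed.

Lemma global_flow : exists Phi : 'rV[R]_n -> R -> 'rV[R]_n,
  [/\ forall x, Phi x 0 = x, forall x, solves (Phi x) & forall t, continuous (Phi^~ t)].
Proof.
have fs x : solves (flow x).
  move=> t i; have := picard_der x (flow x) t i (flow_cont x).
  by move=> /der_eqf; apply => s; rewrite -flow_fix.
have f0 x : flow x 0 = x by rewrite flow_fix picard0.
exists flow; split=> // t x; apply/(@cvgrPdist_le _ _ _ (nbhs x) (nbhs_filter x) (flow^~ t)) => e e0.
pose C := n%:R * expR (2 * L * n%:R * `|t|).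
have C0 : 0 < C + 1 by rewrite ltr_wpDl // mulr_ge0 // expR_ge0.
have d0 : 0 < e / (C + 1) by rewrite divr_gt0.
apply/nbhs_ballP; exists (e / (C + 1)) => // y; rewrite -ball_normE /= => xy.
rewrite -ler_sqr ?nnegrE ?(ltW e0) // (le_trans (solves_gronwall _ _ t (fs x) (fs y))) // !f0.
rewrite mulrAC -/C.
have xy2 : `|x - y| * (C + 1) <= e by rewrite -ler_pdivlMr // ltW.
have h1 : C <= (C + 1) ^+ 2 by nra.
apply: (le_trans (ler_wpM2r (sqr_ge0 _) h1)).
rewrite -exprMn mulrC ler_sqr ?nnegrE ?mulr_ge0 // ltW //.
Qed.

End GlobalFlow.

(** * The extended pendulum *)

Section Coordinates.
Context {R : realType} {n : nat}.

Definition co (k : nat) (X : 'rV[R]_n.+1) : R := X 0 (inord k).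
Definition mk (s : seq R) : 'rV[R]_n.+1 := \row_i s`_i.

Lemma co_mk s k : (k < n.+1)%N -> co k (mk s) = s`_k.
Proof. by move=> kn; rewrite /co mxE inordK. Qed.

Lemma co_ord (X : 'rV[R]_n.+1) (i : 'I_n.+1) : X 0 i = co i X.
Proof. by rewrite /co inord_val. Qed.

Lemma mk_ord s (i : 'I_n.+1) : mk s 0 i = s`_i.
Proof. by rewrite mxE. Qed.

Lemma co_lip k (X Y : 'rV[R]_n.+1) : `|co k X - co k Y| <= `|X - Y|.
Proof. by rewrite /co -rVB coord_norm_le. Qed.

End Coordinates.

Lemma max_lip {R : realType} (a b a' b' d : R) : `|a - a'| <= d -> `|b - b'| <= d ->
  `|Num.max a b - Num.max a' b'| <= d.
Proof.
rewrite !ler_norml => /andP[? ?] /andP[? ?]; apply/andP.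
by rewrite /Num.max; case: (ltP a b) => ?; case: (ltP a' b') => ?; split; lra.
Qed.

Lemma norm_lip {R : realType} (a a' d : R) : `|a - a'| <= d -> `| `|a| - `|a'| | <= d.
Proof. by apply: le_trans; exact: ler_dist_dist. Qed.

Section BoundedLipschitz.
Context {R : realType} {V : normedModType R}.
Implicit Types (h k : R -> V -> R).

(** Boundedness is carried along because it makes the class stable under products; all constants are
    uniform in time. *)
Definition bdlip h := exists C D : R, [/\ 0 <= C, 0 <= D, forall t X, `|h t X| <= C
  & forall t X Y, `|h t X - h t Y| <= D * `|X - Y|].

Lemma bdlip_add h k : bdlip h -> bdlip k -> bdlip (fun t X => h t X + k t X).
Proof.
move=> [C [D [C0 D0 hC hD]]] [C' [D' [C0' D0' kC kD]]].
exists (C + C'), (D + D'); split; rewrite ?addr_ge0 // => t X.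
  by rewrite (le_trans (ler_normD _ _)) // lerD.
by move=> Y; rewrite opprD addrACA mulrDl (le_trans (ler_normD _ _)) // lerD.
Qed.

Lemma bdlip_mul h k : bdlip h -> bdlip k -> bdlip (fun t X => h t X * k t X).
Proof.
move=> [C [D [C0 D0 hC hD]]] [C' [D' [C0' D0' kC kD]]].
exists (C * C'), (C' * D + C * D'); split; rewrite ?addr_ge0 ?mulr_ge0 // => t X.
  by rewrite normrM ler_pM.
move=> Y; rewrite (_ : _ - _ = (h t X - h t Y) * k t X + h t Y * (k t X - k t Y)); last by ring.
rewrite (le_trans (ler_normD _ _)) // !normrM.
have h1 := ler_pM (normr_ge0 _) (normr_ge0 _) (hD t X Y) (kC t X).
have h2 := ler_pM (normr_ge0 _) (normr_ge0 _) (hC t Y) (kD t X Y).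
by rewrite (le_trans (lerD h1 h2)) // le_eqVlt; apply/orP; left; apply/eqP; ring.
Qed.

Lemma bdlip_time (c : R -> R) (C : R) : (forall t, `|c t| <= C) -> bdlip (fun t _ => c t).
Proof.
move=> cC; exists C, 0; split=> //; first exact: le_trans (cC 0).
by move=> t X Y; rewrite subrr normr0 mul0r.
Qed.

Lemma bdlip_cst (c : R) : bdlip (fun _ _ => c).
Proof. exact: (bdlip_time (fun=> c) `|c|). Qed.

Lemma bdlip_sub h k : bdlip h -> bdlip k -> bdlip (fun t X => h t X - k t X).
Proof.
move=> hh kk; rewrite (_ : (fun t X => _) = fun t X => h t X + (-1) * k t X).
  by apply: bdlip_add => //; apply: bdlip_mul => //; exact: bdlip_cst.
by apply/funext => t; apply/funext => X; rewrite mulN1r.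
Qed.

(** As [M] dominates both [r] and [|a|], the factor [r / M] is at most 1, and a change of [M] costs
    no more than a change of [a]; this gives the constant 2. *)
Lemma bdlip_clamp (r : R) (a M : V -> R) : 0 < r ->
  (forall X, r <= M X) -> (forall X, `|a X| <= M X) ->
  (forall X Y, `|a X - a Y| <= `|X - Y|) -> (forall X Y, `|M X - M Y| <= `|X - Y|) ->
  bdlip (fun _ X => r / M X * a X).
Proof.
move=> r0 rM aM al Ml; have M0 X : 0 < M X := lt_le_trans r0 (rM X).
exists r, 2; split=> // [|t X|t X Y]; first exact: ltW.
  by rewrite normrM normf_div [ `|r|]gtr0_norm // [ `|M X|]gtr0_norm // mulrAC ler_pdivrMr // ler_pM2l.
rewrite (_ : _ - _ = r / M X * (a X - a Y + a Y / M Y * (M Y - M X))); last first.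
  by field; rewrite !gt_eqF.
rewrite normrM gtr0_norm ?divr_gt0 //.
apply: (@le_trans _ _ (1 * (`|X - Y| + 1 * `|X - Y|))); last by lra.
apply: ler_pM; rewrite ?divr_ge0 ?(ltW (M0 _)) ?(ltW r0) // ?ler_pdivrMr ?mul1r //.
rewrite (le_trans (ler_normD _ _)) // lerD // normrM -[leRHS]mul1r ler_pM //.
  by rewrite normf_div [ `|M Y|]gtr0_norm // ler_pdivrMr // mul1r.
by rewrite distrC.
Qed.

End BoundedLipschitz.

(** * The extended field and its Lipschitz bounds *)

Section ExtendedField.
Context {R : realType}.
Variables (l m g mu K W : R) (Fx Fy b1 b2 b3 : R -> R).
Implicit Types (t : R) (X Y : 'rV[R]_6).

Definition force1 t (v1 v2 v3 : R) : R := Fx t - mu * v1 + (v2 * b3 t - v3 * b2 t).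
Definition force2 t (v1 v2 v3 : R) : R := Fy t - mu * v2 + (v3 * b1 t - v1 * b3 t).
Definition force3 t (v1 v2 v3 : R) : R := v1 * b2 t - v2 * b1 t - mu * v3 - m * g.

(* The state [X] lists the position [(x, y, z)] and a vector [w] encoding the velocity as
   [w x N], where [N = (x, y, max(z, 0))]; the surface [|N| = l] is the hemisphere continued
   downwards by a cylinder. *)
Definition zplus X : R := Num.max 0 (co 2 X).
Definition zminus X : R := Num.max 0 (- co 2 X).
(** The value is 1 for [z >= -1] and 0 for [z <= -2], with a Lipschitz transition. *)
Definition freeze X : R := Num.min 1 (Num.max 0 (2 + co 2 X)).

(* Dividing by these sizes truncates [N] and [w] without changing their directions, so that the
   field is globally Lipschitz and orthogonality relations survive. *)
Definition sizeN X : R := Num.max l (Num.max `|co 0 X| (Num.max `|co 1 X| `|zplus X|)).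
Definition sizeW X : R := Num.max W (Num.max `|co 3 X| (Num.max `|co 4 X| `|co 5 X|)).

Definition n1 X : R := l / sizeN X * co 0 X.
Definition n2 X : R := l / sizeN X * co 1 X.
Definition n3 X : R := l / sizeN X * zplus X.
Definition w1 X : R := W / sizeW X * co 3 X.
Definition w2 X : R := W / sizeW X * co 4 X.
Definition w3 X : R := W / sizeW X * co 5 X.

Definition v1 X : R := w2 X * n3 X - w3 X * n2 X.
Definition v2 X : R := w3 X * n1 X - w1 X * n3 X.
Definition v3 X : R := w1 X * n2 X - w2 X * n1 X.
Definition spin X : R := w1 X * n1 X + w2 X * n2 X + w3 X * n3 X.

Definition f1 t X : R := force1 t (v1 X) (v2 X) (v3 X).
Definition f2 t X : R := force2 t (v1 X) (v2 X) (v3 X).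
Definition f3 t X : R := force3 t (v1 X) (v2 X) (v3 X).

(* On the sphere, [w = (N x v + k N) / l ^ 2] with [k = (w, N)]: differentiating it for
   [m v' = F + lambda N] and [m k' = - mu k] gives these formulas, which contain no [1_{z > 0}]
   and hence stay Lipschitz across the equator. *)
Definition dw1 t X : R :=
  (n2 X * f3 t X - n3 X * f2 t X - mu * spin X * n1 X + m * spin X * v1 X) * (m * l ^+ 2)^-1.
Definition dw2 t X : R :=
  (n3 X * f1 t X - n1 X * f3 t X - mu * spin X * n2 X + m * spin X * v2 X) * (m * l ^+ 2)^-1.
Definition dw3 t X : R :=
  (n1 X * f2 t X - n2 X * f1 t X - mu * spin X * n3 X + m * spin X * v3 X) * (m * l ^+ 2)^-1.

(* Below the equator the vertical drift and the freezing of the horizontal motion make every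
   motion that is deep enough sink along a generatrix of the cylinder. *)
Definition ext_field t X : 'rV[R]_6 :=
  mk [:: freeze X * v1 X; freeze X * v2 X; v3 X - K * zminus X; dw1 t X; dw2 t X; dw3 t X].

Hypotheses (l_gt0 : 0 < l) (W_gt0 : 0 < W).

Let zplus_lip X Y : `|zplus X - zplus Y| <= `|X - Y|.
Proof. by apply: max_lip; rewrite ?subrr ?normr0 // co_lip. Qed.

Let zminus_lip X Y : `|zminus X - zminus Y| <= `|X - Y|.
Proof. by apply: max_lip; rewrite ?subrr ?normr0 // -opprD normrN co_lip. Qed.

Let sizeN_lip X Y : `|sizeN X - sizeN Y| <= `|X - Y|.
Proof.
apply: max_lip; first by rewrite subrr normr0.
by apply: max_lip; [|apply: max_lip]; apply: norm_lip; rewrite ?zplus_lip ?co_lip.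
Qed.

Let sizeW_lip X Y : `|sizeW X - sizeW Y| <= `|X - Y|.
Proof.
apply: max_lip; first by rewrite subrr normr0.
by apply: max_lip; [|apply: max_lip]; apply: norm_lip; rewrite co_lip.
Qed.

Let n1_bdlip : bdlip (fun _ : R => n1).
Proof. by apply: bdlip_clamp => // X *; rewrite ?co_lip // /sizeN !le_max !lexx ?orbT. Qed.
Let n2_bdlip : bdlip (fun _ : R => n2).
Proof. by apply: bdlip_clamp => // X *; rewrite ?co_lip // /sizeN !le_max !lexx ?orbT. Qed.
Let n3_bdlip : bdlip (fun _ : R => n3).
Proof. by apply: bdlip_clamp => // X *; rewrite ?zplus_lip // /sizeN !le_max !lexx ?orbT. Qed.
Let w1_bdlip : bdlip (fun _ : R => w1).
Proof. by apply: bdlip_clamp => // X *; rewrite ?co_lip // /sizeW !le_max !lexx ?orbT. Qed.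
Let w2_bdlip : bdlip (fun _ : R => w2).
Proof. by apply: bdlip_clamp => // X *; rewrite ?co_lip // /sizeW !le_max !lexx ?orbT. Qed.
Let w3_bdlip : bdlip (fun _ : R => w3).
Proof. by apply: bdlip_clamp => // X *; rewrite ?co_lip // /sizeW !le_max !lexx ?orbT. Qed.

Let freeze_bdlip : bdlip (fun _ : R => freeze).
Proof.
exists 1, 1; split=> // [_ X|_ X Y].
  rewrite /freeze ger0_norm ?ge_min ?lexx // le_min ler01 le_max lexx //.
rewrite mul1r /freeze; have : `|Num.max 0 (2 + co 2 X) - Num.max 0 (2 + co 2 Y)| <= `|X - Y|.
  by apply: max_lip; rewrite ?subrr ?normr0 // opprD addrACA subrr add0r co_lip.
move: (Num.max _ _) (Num.max _ _) => a b; rewrite !ler_norml => /andP[? ?]; apply/andP.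
by rewrite /Num.min; case: (ltP 1 a) => ?; case: (ltP 1 b) => ?; split; lra.
Qed.

Variable Q : R.
Hypotheses (Fx_bnd : forall t, `|Fx t| <= Q) (Fy_bnd : forall t, `|Fy t| <= Q).
Hypotheses (b1_bnd : forall t, `|b1 t| <= Q) (b2_bnd : forall t, `|b2 t| <= Q).
Hypotheses (b3_bnd : forall t, `|b3 t| <= Q).

Let Fx_bdlip : bdlip (fun t (_ : 'rV[R]_6) => Fx t) := bdlip_time Fx Q Fx_bnd.
Let Fy_bdlip : bdlip (fun t (_ : 'rV[R]_6) => Fy t) := bdlip_time Fy Q Fy_bnd.
Let b1_bdlip : bdlip (fun t (_ : 'rV[R]_6) => b1 t) := bdlip_time b1 Q b1_bnd.
Let b2_bdlip : bdlip (fun t (_ : 'rV[R]_6) => b2 t) := bdlip_time b2 Q b2_bnd.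
Let b3_bdlip : bdlip (fun t (_ : 'rV[R]_6) => b3 t) := bdlip_time b3 Q b3_bnd.

Ltac bdlip_auto :=
  lazymatch goal with
  | |- bdlip (fun t X => @?h t X - @?k t X) => apply: (bdlip_sub h k); bdlip_auto
  | |- bdlip (fun t X => @?h t X + @?k t X) => apply: (bdlip_add h k); bdlip_auto
  | |- bdlip (fun t X => @?h t X * @?k t X) => apply: (bdlip_mul h k); bdlip_auto
  | |- _ => first [ exact: bdlip_cst | assumption ]
  end.

Let v1_bdlip : bdlip (fun _ : R => v1). Proof. by rewrite /v1; bdlip_auto. Qed.
Let v2_bdlip : bdlip (fun _ : R => v2). Proof. by rewrite /v2; bdlip_auto. Qed.
Let v3_bdlip : bdlip (fun _ : R => v3). Proof. by rewrite /v3; bdlip_auto. Qed.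
Let spin_bdlip : bdlip (fun _ : R => spin). Proof. by rewrite /spin; bdlip_auto. Qed.
Let f1_bdlip : bdlip f1. Proof. by rewrite /f1 /force1; bdlip_auto. Qed.
Let f2_bdlip : bdlip f2. Proof. by rewrite /f2 /force2; bdlip_auto. Qed.
Let f3_bdlip : bdlip f3. Proof. by rewrite /f3 /force3; bdlip_auto. Qed.
Let dw1_bdlip : bdlip dw1. Proof. by rewrite /dw1; bdlip_auto. Qed.
Let dw2_bdlip : bdlip dw2. Proof. by rewrite /dw2; bdlip_auto. Qed.
Let dw3_bdlip : bdlip dw3. Proof. by rewrite /dw3; bdlip_auto. Qed.

Lemma ext_field_ord t X (i : 'I_6) : ext_field t X 0 i =
  nth 0 [:: freeze X * v1 X; freeze X * v2 X; v3 X - K * zminus X; dw1 t X; dw2 t X; dw3 t X] i.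
Proof. exact: mk_ord. Qed.

Lemma ext_field_lip : exists L M : R, [/\ 0 < L,
  forall t X Y, `|ext_field t X - ext_field t Y| <= L * `|X - Y| & forall t, `|ext_field t 0| <= M].
Proof.
have lip (h : R -> 'rV[R]_6 -> R) : bdlip h -> exists p : R * R, forall t,
    (forall X Y, `|h t X - h t Y| <= p.1 * `|X - Y|) /\ `|h t 0| <= p.2.
  by move=> [M [L [_ _ hM hL]]]; exists (L, M).
(* The vertical component is treated apart: [zminus] makes it unbounded, so it falls outside
   [bdlip]. *)
have z_lip : exists p : R * R, forall t : R,
    (forall X Y, `|(v3 X - K * zminus X) - (v3 Y - K * zminus Y)| <= p.1 * `|X - Y|) /\
    `|v3 0 - K * zminus 0| <= p.2.
  have [[L M] H] := lip _ v3_bdlip.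
  exists (L + `|K|, `|v3 0 - K * zminus 0|) => t; split=> // X Y /=.
  rewrite opprD addrACA mulrDl (le_trans (ler_normD _ _)) // lerD //; first exact: (H 0).1.
  by rewrite -opprD normrN -mulrBr normrM ler_wpM2l.
have comp (i : 'I_6) : exists p : R * R, forall t,
    (forall X Y, `|ext_field t X 0 i - ext_field t Y 0 i| <= p.1 * `|X - Y|) /\ `|ext_field t 0 0 i| <= p.2.
  have [p Hp] : exists p : R * R, forall t,
    (forall X Y, `|nth 0 [:: freeze X * v1 X; freeze X * v2 X; v3 X - K * zminus X;
                      dw1 t X; dw2 t X; dw3 t X] i -
      nth 0 [:: freeze Y * v1 Y; freeze Y * v2 Y; v3 Y - K * zminus Y;
                      dw1 t Y; dw2 t Y; dw3 t Y] i| <= p.1 * `|X - Y|) /\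
    `|nth 0 [:: freeze 0 * v1 0; freeze 0 * v2 0; v3 0 - K * zminus 0;
                      dw1 t 0; dw2 t 0; dw3 t 0] i| <= p.2.
    case: i => -[|[|[|[|[|[|i]]]]]] //= _; [| |exact: lip|exact: lip|exact: lip].
    - exact: (lip _ (bdlip_mul _ _ freeze_bdlip v1_bdlip)).
    - exact: (lip _ (bdlip_mul _ _ freeze_bdlip v2_bdlip)).
  by exists p => t; rewrite ext_field_ord; split=> [X Y|]; [rewrite !ext_field_ord; exact: (Hp t).1|exact: (Hp t).2].
have [p Hp] := choice comp.
have le_sum (a : 'I_6 -> R) i : a i <= \sum_j `|a j|.
  by rewrite (bigD1 i) //= (le_trans (ler_norm _)) // lerDl sumr_ge0.
exists (1 + \sum_j `|(p j).1|), (\sum_j `|(p j).2|); split=> [|t X Y|t].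
- by rewrite ltr_wpDr // sumr_ge0.
- apply: norm_rV_le => [|i]; first by rewrite mulr_ge0 // addr_ge0 // sumr_ge0.
  rewrite rVB (le_trans ((Hp i t).1 X Y)) // ler_wpM2r //.
  by rewrite (le_trans (le_sum (fun j => (p j).1) i)) // lerDr.
- apply: norm_rV_le => [|i]; first by rewrite sumr_ge0.
  by rewrite (le_trans (Hp i t).2) // (le_sum (fun j => (p j).2) i).
Qed.

Ltac cont_auto :=
  lazymatch goal with
  | |- continuous (fun t => @?h t - @?k t) => apply: (contB h k); cont_auto
  | |- continuous (fun t => @?h t + @?k t) => apply: (contD h k); cont_auto
  | |- continuous (fun t => @?h t * @?k t) => apply: (contM h k); cont_auto
  | |- _ => first [ exact: cont_cst | assumption ]
  end.

Lemma ext_field_cont X i : continuous Fx -> continuous Fy -> continuous b1 -> continuous b2 ->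
  continuous b3 -> continuous (fun t => ext_field t X 0 i).
Proof.
move=> ? ? ? ? ?.
rewrite (_ : (fun t => _) = fun t => nth 0 [:: freeze X * v1 X; freeze X * v2 X;
    v3 X - K * zminus X; dw1 t X; dw2 t X; dw3 t X] i); last first.
  by apply/funext => t; rewrite ext_field_ord.
case: i => -[|[|[|[|[|[|i]]]]]] //= _; rewrite /dw1 /dw2 /dw3 /f1 /f2 /f3 /force1 /force2 /force3;
  cont_auto.
Qed.

End ExtendedField.

Lemma cont_max {R : realType} {T : topologicalType} (f g : T -> R) :
  continuous f -> continuous g -> continuous (fun x => Num.max (f x) (g x)).
Proof.
move=> fc gc x; apply/cvgrPdist_le => e e0; near=> y.
by apply: max_lip; near: y; [move: (fc x)|move: (gc x)] => /cvgrPdist_le/(_ e e0).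
Unshelve. all: by end_near. Qed.

(** Squaring smooths the corner: at 0 the positive part itself is the continuous difference
    quotient. *)
Lemma der_max0_sq {R : realType} (z : R) :
  is_derive z 1 (fun s => Num.max 0 s * Num.max 0 s) (2 * Num.max 0 z).
Proof.
have [z0|z0|z0] := ltgtP z 0.
- rewrite mulr0; apply: (near_eq_is_derive _ (der_cst 0 z)).
  exists (- z); rewrite /= ?oppr_gt0 // => s; rewrite /ball_ /= => zs.
  by rewrite max_l ?mulr0 //; have := ler_norm (s - z); rewrite distrC in zs; lra.
- apply: (near_eq_is_derive _ (der_eqd (derM (der_id z) (der_id z)) _)); last by ring.
  exists z => //= s; rewrite /ball_ /= => zs.
  by rewrite max_r //; have := ler_norm (z - s); lra.
- rewrite z0 ?maxxx mulr0; apply/is_derive1_caratheodory; exists (Num.max 0); split.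
  + by move=> s /=; rewrite maxxx mulr0 !subr0 /Num.max; case: ltP => ?; rewrite ?mul0r ?mulr0.
  + have idc : continuous (fun s : R => s) by move=> s; exact: cvg_id.
    exact: (cont_max _ _ (cont_cst 0) idc).
  + by rewrite maxxx.
Qed.

Lemma le_of_sqr {R : realType} (a b : R) : 0 <= b -> a * a <= b * b -> a <= b.
Proof. by move=> b0 ab; rewrite leNgt; apply/negP => ?; nra. Qed.

Lemma norm_le_of_sqr {R : realType} (a b : R) : 0 <= b -> a * a <= b * b -> `|a| <= b.
Proof. by move=> b0 ab; rewrite ler_norml; apply/andP; split; nra. Qed.

Lemma periodic_mod {R : realType} {T : zmodType} (f : R -> T) (tau : R) : 0 < tau ->
  periodic f tau -> forall t, exists2 s, 0 <= s <= tau & f s = f t.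
Proof.
move=> tau0 fp; have pos t : 0 <= t -> exists2 s, 0 <= s <= tau & f s = f t.
  move=> t0; pose k := Num.truncn (t / tau).
  have /andP[k1 k2] : k%:R <= t / tau < k.+1%:R by rewrite truncn_itv // divr_ge0 // ltW.
  exists (t - tau *+ k); last by rewrite -{2}(subrK (tau *+ k) t) periodicn.
  move: k1 k2; rewrite ler_pdivlMr // ltr_pdivrMr // -mulr_natl -natr1 mulrDl mul1r => k1 k2.
  by apply/andP; split; lra.
move=> t; have [t0|t0] := leP 0 t; first exact: pos.
have [k /ltW tk] : exists k : nat, - t / tau < k%:R.
  by exists (Num.bound (- t / tau)); apply: archi_boundP; rewrite divr_ge0 ?oppr_ge0 // ltW.
have [|s s0 fs] := pos (t + tau *+ k); last by exists s => //; rewrite fs periodicn.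
by move: tk; rewrite ler_pdivrMr // -mulr_natl; lra.
Qed.

(** * A priori estimates for the extended motion *)

Section Dynamics.
Context {R : realType}.
Variables (l m g mu c V : R) (Fx Fy b1 b2 b3 : R -> R).
Hypotheses (l_gt0 : 0 < l) (m_gt0 : 0 < m) (g_gt0 : 0 < g) (mu_gt0 : 0 < mu).
Hypotheses (V_gt0 : 0 < V) (V_sqr : m / 2 * (V * V) = c).
Hypothesis friction : forall t,
  Num.sqrt (Fx t * Fx t + Fy t * Fy t) + m * g < mu * V.
Hypothesis gravity : forall v1 v2 : R, m / 2 * (v1 * v1 + v2 * v2) <= c ->
  forall t, v1 * b2 t - v2 * b1 t < m * g.

Let W := V / l.
Let K := V + 1.
Let fld := ext_field l m g mu K W Fx Fy b1 b2 b3.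

Local Notation n1 := (n1 l).
Local Notation n2 := (n2 l).
Local Notation n3 := (n3 l).
Local Notation w1 := (w1 W).
Local Notation w2 := (w2 W).
Local Notation w3 := (w3 W).
Local Notation v1 := (v1 l W).
Local Notation v2 := (v2 l W).
Local Notation v3 := (v3 l W).
Local Notation spin := (spin l W).
Local Notation f1 := (f1 l mu W Fx b2 b3).
Local Notation f2 := (f2 l mu W Fy b1 b3).
Local Notation f3 := (f3 l m g mu W b1 b2).
Local Notation dw1 := (dw1 l m g mu W Fy b1 b2 b3).
Local Notation dw2 := (dw2 l m g mu W Fx b1 b2 b3).
Local Notation dw3 := (dw3 l m mu W Fx Fy b1 b2 b3).

Definition shape (X : 'rV[R]_6) := co 0 X * co 0 X + co 1 X * co 1 X + zplus X * zplus X.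
Definition energy (X : 'rV[R]_6) := co 3 X * co 3 X + co 4 X * co 4 X + co 5 X * co 5 X.

Let W_gt0 : 0 < W. Proof. by rewrite divr_gt0. Qed.
Let lW : l * W = V. Proof. by rewrite /W mulrC divfK // gt_eqF. Qed.

Lemma shape_id X : shape X = l * l ->
  [/\ n1 X = co 0 X, n2 X = co 1 X & n3 X = zplus X].
Proof.
rewrite /shape => H.
have a0 : 0 <= co 0 X * co 0 X by rewrite -expr2 sqr_ge0.
have a1 : 0 <= co 1 X * co 1 X by rewrite -expr2 sqr_ge0.
have a2 : 0 <= zplus X * zplus X by rewrite -expr2 sqr_ge0.
have sl : sizeN l X = l.
  by rewrite /sizeN max_l // !ge_max !norm_le_of_sqr ?(ltW l_gt0) //; lra.
by rewrite /n1 /n2 /n3 sl divff ?mul1r // gt_eqF.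
Qed.

Lemma energy_id X : energy X <= W * W -> [/\ w1 X = co 3 X, w2 X = co 4 X & w3 X = co 5 X].
Proof.
rewrite /energy => H.
have a0 : 0 <= co 3 X * co 3 X by rewrite -expr2 sqr_ge0.
have a1 : 0 <= co 4 X * co 4 X by rewrite -expr2 sqr_ge0.
have a2 : 0 <= co 5 X * co 5 X by rewrite -expr2 sqr_ge0.
have sl : sizeW W X = W.
  by rewrite /sizeW max_l // !ge_max !norm_le_of_sqr ?(ltW W_gt0) //; lra.
by rewrite /w1 /w2 /w3 sl divff ?mul1r // gt_eqF.
Qed.

(** This is Lagrange's identity for [w x N] and [(w, N)], with [|N| = l]. *)
Lemma speed_sqr X : shape X = l * l -> energy X <= W * W ->
  v1 X * v1 X + v2 X * v2 X + v3 X * v3 X + spin X * spin X = (l * l) * energy X.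
Proof.
move=> HN HW; have [N1 N2 N3] := shape_id _ HN; have [W1 W2 W3] := energy_id _ HW.
by rewrite /v1 /v2 /v3 /spin N1 N2 N3 W1 W2 W3 -HN /shape /energy; ring.
Qed.

Lemma speed_le X : shape X = l * l -> energy X <= W * W ->
  v1 X * v1 X + v2 X * v2 X + v3 X * v3 X <= V * V.
Proof.
move=> HN HW; have := speed_sqr X HN HW; have : 0 <= spin X * spin X by rewrite -expr2 sqr_ge0.
have : l * l * energy X <= V * V by rewrite -lW mulrACA ler_pM2l ?mulr_gt0.
lra.
Qed.

Lemma v3_bound X : shape X = l * l -> energy X <= W * W -> - V <= v3 X <= V.
Proof.
move=> HN HW; have := speed_le X HN HW.
have : 0 <= v1 X * v1 X by rewrite -expr2 sqr_ge0.
have : 0 <= v2 X * v2 X by rewrite -expr2 sqr_ge0.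
move=> ? ? ?; have : `|v3 X| <= V by apply: norm_le_of_sqr; [exact: ltW|lra].
by rewrite ler_norml.
Qed.

(** On the boundary of the ball [|v|^2 + spin^2 = V^2], so the frictions on velocity and spin
    together dissipate [mu V^2]. The magnetic force does no work, and the remaining forces supply at
    most [(|F| + m g) V]. *)
Lemma energy_decreases X t : shape X = l * l -> energy X = W * W ->
  co 3 X * dw1 t X + co 4 X * dw2 t X + co 5 X * dw3 t X < 0.
Proof.
move=> HN HW; have HW' : energy X <= W * W by rewrite HW.
have [W1 W2 W3] := energy_id _ HW'.
have := speed_sqr X HN HW'; rewrite HW mulrACA lW => sp.
have := speed_le X HN HW' => vV.
have I0 : 0 < (m * l ^+ 2)^-1 by rewrite invr_gt0 mulr_gt0 ?exprn_gt0.
rewrite -W1 -W2 -W3 (_ : _ + _ + _ = (f1 t X * v1 X + f2 t X * v2 X + f3 t X * v3 X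
  - mu * (spin X * spin X)) * (m * l ^+ 2)^-1); last first.
  by rewrite /dw1 /dw2 /dw3 /v1 /v2 /v3 /spin; ring.
rewrite pmulr_llt0 //.
rewrite /f1 /f2 /f3 /force1 /force2 /force3.
rewrite (_ : _ - _ = Fx t * v1 X + Fy t * v2 X - m * g * v3 X
   - mu * (v1 X * v1 X + v2 X * v2 X + v3 X * v3 X + spin X * spin X)); last by ring.
rewrite sp; have := friction t; set a := Num.sqrt _ => fr.
have a0 : 0 <= a by exact: sqrtr_ge0.
have aE : a * a = Fx t * Fx t + Fy t * Fy t.
  by rewrite -expr2 sqr_sqrtr // addr_ge0 // -expr2 sqr_ge0.
move: (v1 X) (v2 X) (v3 X) vV => p1 p2 p3 vV.
have s1 : 0 <= p1 * p1 by rewrite -expr2 sqr_ge0.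
have s2 : 0 <= p2 * p2 by rewrite -expr2 sqr_ge0.
have s3 : 0 <= p3 * p3 by rewrite -expr2 sqr_ge0.
(* Cauchy-Schwarz in the plane, then [p1^2 + p2^2 <= V^2]. *)
have h1 : Fx t * p1 + Fy t * p2 <= a * V.
  apply: le_of_sqr; first by rewrite mulr_ge0 // ltW.
  apply: (@le_trans _ _ ((a * a) * (p1 * p1 + p2 * p2))).
    rewrite aE; have := sqr_ge0 (Fx t * p2 - Fy t * p1); rewrite expr2; lra.
  by rewrite mulrACA ler_wpM2l ?mulr_ge0 //; lra.
have h2 : - p3 <= V by apply: le_of_sqr; [exact: ltW|lra].
have mg0 : 0 < m * g by rewrite mulr_gt0.
have h3 : m * g * (- p3) <= m * g * V by rewrite ler_pM2l.
have h4 : (a + m * g) * V < mu * V * V by rewrite ltr_pM2r.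
lra.
Qed.

(** * Invariants, sinking and positivity along one solution *)

Section Solution.
Variable y : R -> 'rV[R]_6.
Hypothesis ysol : solves fld y.

Lemma sol_der k (t : R) : (k < 6)%N -> is_derive t 1 (fun s => co k (y s)) (co k (fld t (y t))).
Proof. by move=> k6; exact: ysol. Qed.

Lemma sol_x (t : R) : is_derive t 1 (fun s => co 0 (y s)) (freeze (y t) * v1 (y t)).
Proof. by have := sol_der 0 t isT; rewrite /fld /ext_field co_mk. Qed.
Lemma sol_y (t : R) : is_derive t 1 (fun s => co 1 (y s)) (freeze (y t) * v2 (y t)).
Proof. by have := sol_der 1 t isT; rewrite /fld /ext_field co_mk. Qed.
Lemma sol_z (t : R) : is_derive t 1 (fun s => co 2 (y s)) (v3 (y t) - K * zminus (y t)).
Proof. by have := sol_der 2 t isT; rewrite /fld /ext_field co_mk. Qed.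
Lemma sol_w1 (t : R) : is_derive t 1 (fun s => co 3 (y s)) (dw1 t (y t)).
Proof. by have := sol_der 3 t isT; rewrite /fld /ext_field co_mk. Qed.
Lemma sol_w2 (t : R) : is_derive t 1 (fun s => co 4 (y s)) (dw2 t (y t)).
Proof. by have := sol_der 4 t isT; rewrite /fld /ext_field co_mk. Qed.
Lemma sol_w3 (t : R) : is_derive t 1 (fun s => co 5 (y s)) (dw3 t (y t)).
Proof. by have := sol_der 5 t isT; rewrite /fld /ext_field co_mk. Qed.

(** [w x N] is orthogonal to [N], also after truncation. Above the equator there is neither freezing
    nor drift; below it [N] is horizontal, so the drift does not matter and freezing only rescales
    the horizontal velocity. *)
Lemma sol_shape t : shape (y t) = shape (y 0).
Proof.
have d (s : R) : is_derive s 1 (fun s => shape (y s)) 0.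
  apply: (der_eqd (derD (derD (derM (sol_x s) (sol_x s)) (derM (sol_y s) (sol_y s)))
    (der_comp (g := fun s => co 2 (y s)) (der_max0_sq (co 2 (y s))) (sol_z s)))).
  rewrite /v1 /v2 /v3 /n1 /n2 /n3 /zplus /zminus /freeze.
  have [z0|z0] := leP (co 2 (y s)) 0; first by ring.
  rewrite (max_l (y := - _)); last by rewrite oppr_le0 ltW.
  rewrite max_r; last by lra.
  by rewrite min_l; [ring|lra].
have [t0|/ltW t0] := leP 0 t; first by rewrite (der0_const _ 0 t t0 (fun s _ => d s)).
exact: (der0_const _ t 0 t0 (fun s _ => d s)).
Qed.

Hypothesis y0_shape : shape (y 0) = l * l.

Let y_shape t : shape (y t) = l * l. Proof. by rewrite sol_shape. Qed.

Lemma sol_energy t : 0 <= t -> energy (y 0) <= W * W -> energy (y t) <= W * W.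
Proof.
move=> t0 e0; apply: (der_barrier (fun s => energy (y s))
  (fun s => 2 * (co 3 (y s) * dw1 s (y s) + co 4 (y s) * dw2 s (y s) + co 5 (y s) * dw3 s (y s)))
  _ 0 t t0 e0) => s _.
  apply: (der_eqd (derD (derD (derM (sol_w1 s) (sol_w1 s)) (derM (sol_w2 s) (sol_w2 s)))
    (derM (sol_w3 s) (sol_w3 s)))).
  by ring.
by move=> es; rewrite pmulr_rlt0 // energy_decreases.
Qed.

(** At depth 2 or more the drift beats every vertical velocity that the energy allows, so the motion
    keeps sinking, and there its horizontal part is frozen. *)
Lemma sol_deep (tau : R) : 0 < tau -> energy (y 0) <= W * W -> co 2 (y 0) = - 2 ->
  [/\ co 0 (y tau) = co 0 (y 0), co 1 (y tau) = co 1 (y 0) & co 2 (y tau) < - 2].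
Proof.
move=> tau0 e0 z0.
have falling (s : R) : 0 <= s -> co 2 (y s) <= - 2 -> v3 (y s) - K * zminus (y s) < 0.
  move=> s0 zs; have /andP[_ vle] := v3_bound _ (y_shape s) (sol_energy s s0 e0).
  have h : 0 <= V * (- co 2 (y s) - 2) by apply: mulr_ge0; [exact: ltW|lra].
  have V0 := V_gt0.
  by rewrite /zminus max_r /K; lra.
have deep (s : R) : 0 <= s -> co 2 (y s) <= - 2.
  move=> s0; apply: (der_barrier _ _ _ 0 s s0 _ (fun t _ => sol_z t)); first by rewrite z0.
  by move=> t /andP[t0 _] zt; apply: falling => //; rewrite zt.
have frozen (s : R) : 0 <= s -> freeze (y s) = 0.
  by move=> /deep zs; rewrite /freeze max_l ?min_r //; lra.
split.
- symmetry; apply: (der0_const (fun s => co 0 (y s)) 0 tau (ltW tau0)) => s /andP[s0 _].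
  by apply: (der_eqd (sol_x s)); rewrite frozen // mul0r.
- symmetry; apply: (der0_const (fun s => co 1 (y s)) 0 tau (ltW tau0)) => s /andP[s0 _].
  by apply: (der_eqd (sol_y s)); rewrite frozen // mul0r.
have [s /andP[/ltW s0 _]] := der_mean _ _ 0 tau tau0 (fun s _ => sol_z s).
rewrite z0 subr0 => E; have := falling s s0 (deep s s0) => F.
by have := pmulr_llt0 (v3 (y s) - K * zminus (y s)) tau0; rewrite F -E => /idP; lra.
Qed.

Hypothesis y_energy : forall t, energy (y t) <= W * W.

Let wE t : [/\ w1 (y t) = co 3 (y t), w2 (y t) = co 4 (y t) & w3 (y t) = co 5 (y t)].
Proof. exact: energy_id. Qed.

Let nE t : [/\ n1 (y t) = co 0 (y t), n2 (y t) = co 1 (y t) & n3 (y t) = zplus (y t)].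
Proof. exact: shape_id. Qed.

(* The term [m k v] in the field cancels the curvature term [k w_z] here. *)
Lemma sol_v3_cylinder (t : R) : -1 < co 2 (y t) <= 0 ->
  is_derive t 1 (fun s => v3 (y s)) (f3 t (y t) / m).
Proof.
move=> /andP[z1 z0].
have := derB (derM (sol_w1 t) (sol_y t)) (derM (sol_w2 t) (sol_x t)).
move=> /der_eqf H; apply: (der_eqd (H (fun s => v3 (y s)) _)).
  by move=> s; have [N1 N2 _] := nE s; have [W1 W2 _] := wE s; rewrite /v3 N1 N2 W1 W2.
have -> : freeze (y t) = 1 by rewrite /freeze max_r ?min_l //; lra.
have [N1 N2 N3] := nE t; have [W1 W2 W3] := wE t.
have zp : zplus (y t) = 0 by rewrite /zplus max_l.
have lE : l ^+ 2 = n1 (y t) * n1 (y t) + n2 (y t) * n2 (y t).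
  by rewrite expr2 -(y_shape t) /shape zp N1 N2; ring.
have l2 : l ^+ 2 != 0 by rewrite expf_neq0 // gt_eqF.
rewrite -N1 -N2 -W1 -W2 /dw1 /dw2 !mul1r.
have N30 : n3 (y t) = 0 by rewrite N3.
rewrite /spin /v1 /v2 N30 lE; field.
by rewrite -lE l2 gt_eqF.
Qed.

(** At a lowest point with [z <= 0], [z' = 0] reads [v3 = K * zminus]. Hence [v3 >= 0], so that
    friction also pulls down, and [v3 <= V < K], so that the depth is less than 1 and
    [sol_v3_cylinder] applies. *)
Lemma sol_positive (tau : R) : 0 < tau -> periodic y tau -> forall t, 0 < co 2 (y t).
Proof.
move=> tau0 yp.
have zc : continuous (fun s => co 2 (y s)) by move=> s; exact: der_continuous_at (sol_z s).
have [t0 _ Ht0] := @EVT_min R (fun s => co 2 (y s)) 0 tau (ltW tau0) (continuous_subspaceT zc).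
have zmin s : co 2 (y t0) <= co 2 (y s).
  by have [s' s01 <-] := periodic_mod y tau tau0 yp s; apply: Ht0; rewrite in_itv.
suff z0 : 0 < co 2 (y t0) by move=> t; exact: lt_le_trans (zmin t).
rewrite ltNge; apply/negP => z0.
have zm : zminus (y t0) = - co 2 (y t0) by rewrite /zminus max_r // oppr_ge0.
have /= p0 := der_min _ _ t0 sol_z zmin.
have /andP[_ vle] := v3_bound _ (y_shape t0) (y_energy t0).
have z1 : -1 < co 2 (y t0).
  rewrite ltNge; apply/negP => z1; have h : 0 <= V * (- 1 - co 2 (y t0)) by apply: mulr_ge0; [exact: ltW|rewrite subr_ge0].
  by move: p0; rewrite zm /K; lra.
have v0 : 0 <= v3 (y t0).
  have h : 0 <= V * - co 2 (y t0) by apply: mulr_ge0; [exact: ltW|rewrite oppr_ge0].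
  by move: p0; rewrite zm /K; lra.
have f30 : f3 t0 (y t0) < 0.
  have sp := speed_le (y t0) (y_shape t0) (y_energy t0).
  have : 0 <= v3 (y t0) * v3 (y t0) by rewrite -expr2 sqr_ge0.
  have := gravity (v1 (y t0)) (v2 (y t0)) _ t0; rewrite /f3 /force3.
  move=> G ?; have {}G := G ltac:(rewrite -V_sqr ler_pM2l ?divr_gt0 //; lra).
  have : 0 <= mu * v3 (y t0) by rewrite mulr_ge0 // ltW.
  lra.
have vd := sol_v3_cylinder t0 ltac:(by rewrite z1).
have neg : f3 t0 (y t0) / m < 0 by rewrite pmulr_llt0 ?invr_gt0.
suff : 0 <= f3 t0 (y t0) / m by rewrite leNgt neg.
(* Two cases, because [zminus] has a corner at 0. If the minimum is 0, [zminus] vanishes along the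
   whole motion; if it is negative, [zminus = - z] near [t0] and has derivative 0 at [t0]. Either
   way [z'' = v3'] there. *)
move: z0; rewrite le_eqVlt => /predU1P[z0|z0].
  apply: (der_min2 _ _ t0 _ sol_z zmin); apply: (der_eqf vd) => s.
  by rewrite /zminus max_l ?mulr0 ?subr0 // oppr_le0 -z0.
apply: (der_min2 _ _ t0 _ sol_z zmin).
have /nbhs_ballP[e e0 He] : \forall s \near t0, co 2 (y s) < 0.
  by apply: (@cvgr_lt _ _ _ _ _ (co 2 (y t0)) (zc t0)).
have := derB vd (derM (der_cst K t0) (derB (der_cst 0 t0) (sol_z t0))).
rewrite p0 mul0r add0r subrr mulr0 subr0; apply: near_eq_is_derive.
exists e => // s ts; rewrite /zminus max_r ?sub0r //.
by rewrite oppr_ge0 ltW //; apply: He; rewrite -ball_normE.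
Qed.

Lemma sol_accel : (forall t, 0 < co 2 (y t)) -> forall t : R, exists lam : R,
  [/\ exists2 d, is_derive t 1 (fun s => v1 (y s)) d & m * d = f1 t (y t) + lam * co 0 (y t),
      exists2 d, is_derive t 1 (fun s => v2 (y s)) d & m * d = f2 t (y t) + lam * co 1 (y t)
    & exists2 d, is_derive t 1 (fun s => v3 (y s)) d & m * d = f3 t (y t) + lam * co 2 (y t)].
Proof.
move=> z0 t.
have nE' s : [/\ n1 (y s) = co 0 (y s), n2 (y s) = co 1 (y s) & n3 (y s) = co 2 (y s)].
  by have [-> -> ->] := nE s; split=> //; rewrite /zplus max_r // ltW.
have fr : freeze (y t) = 1 by rewrite /freeze max_r ?min_l //; have := z0 t; lra.
have zm : zminus (y t) = 0 by rewrite /zminus max_l // oppr_le0 ltW.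
have xd := sol_x t; have yd := sol_y t; have zd := sol_z t.
rewrite fr mul1r in xd; rewrite fr mul1r in yd; rewrite zm mulr0 subr0 in zd.
have [N1 N2 N3] := nE' t; have [W1 W2 W3] := wE t.
have lE : l ^+ 2 = n1 (y t) * n1 (y t) + n2 (y t) * n2 (y t) + n3 (y t) * n3 (y t).
  by rewrite expr2 -(y_shape t) /shape /zplus max_r ?ltW // N1 N2 N3.
have l2 : l ^+ 2 != 0 by rewrite expf_neq0 // gt_eqF.
have m0 : m != 0 by rewrite gt_eqF.
have V1 s : co 4 (y s) * co 2 (y s) - co 5 (y s) * co 1 (y s) = v1 (y s).
  by have [E1 E2 E3] := nE' s; have [D1 D2 D3] := wE s; rewrite /v1 E2 E3 D2 D3.
have V2 s : co 5 (y s) * co 0 (y s) - co 3 (y s) * co 2 (y s) = v2 (y s).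
  by have [E1 E2 E3] := nE' s; have [D1 D2 D3] := wE s; rewrite /v2 E1 E3 D1 D3.
have V3 s : co 3 (y s) * co 1 (y s) - co 4 (y s) * co 0 (y s) = v3 (y s).
  by have [E1 E2 E3] := nE' s; have [D1 D2 D3] := wE s; rewrite /v3 E1 E2 D1 D2.
(* Since [l^2 |w|^2 = |v|^2 + spin^2], this multiplier equals [- ((f, N) + m |v|^2) / l^2], the
   reaction obtained by differentiating [(v, N) = 0]. *)
exists (- (f1 t (y t) * n1 (y t) + f2 t (y t) * n2 (y t) + f3 t (y t) * n3 (y t)) / l ^+ 2
  + m * (spin (y t) * spin (y t)) / l ^+ 2
  - m * (w1 (y t) * w1 (y t) + w2 (y t) * w2 (y t) + w3 (y t) * w3 (y t))).
split.
- refine (ex_intro2 _ _ _ (der_eqf (derB (derM (sol_w2 t) zd) (derM (sol_w3 t) yd)) V1) _).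
  by rewrite -N1 -N2 -N3 -W2 -W3 /dw2 /dw3 /spin /v1 /v2 /v3 lE; field; rewrite -lE l2.
- refine (ex_intro2 _ _ _ (der_eqf (derB (derM (sol_w3 t) xd) (derM (sol_w1 t) zd)) V2) _).
  by rewrite -N1 -N2 -N3 -W1 -W3 /dw1 /dw3 /spin /v1 /v2 /v3 lE; field; rewrite -lE l2.
- refine (ex_intro2 _ _ _ (der_eqf (derB (derM (sol_w1 t) yd) (derM (sol_w2 t) xd)) V3) _).
  by rewrite -N1 -N2 -N3 -W1 -W2 /dw1 /dw2 /spin /v1 /v2 /v3 lE; field; rewrite -lE l2.
Qed.

End Solution.


(** * A planar chart of the surface and the initial states *)

Definition hypot (a b : R) : R := Num.sqrt (a * a + b * b).
(** Multiplying a vector of norm [s] by this factor is the radial retraction onto the ball of radius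
    [r]. *)
Definition shrink (r s : R) : R := r / Num.max r s.

Lemma hypot_sqr a b : hypot a b * hypot a b = a * a + b * b.
Proof. by rewrite -expr2 sqr_sqrtr // addr_ge0 // -expr2 sqr_ge0. Qed.

Lemma hypot_ge0 a b : 0 <= hypot a b. Proof. exact: sqrtr_ge0. Qed.

Lemma shrink_id r s : 0 < r -> s <= r -> shrink r s = 1.
Proof. by move=> r0 sr; rewrite /shrink max_l // divff // gt_eqF. Qed.

Lemma shrink_mul r s : 0 < r -> 0 <= s -> 0 <= shrink r s * s <= r.
Proof.
move=> r0 s0; rewrite /shrink; have m0 : 0 < Num.max r s by rewrite lt_max r0.
rewrite mulr_ge0 ?divr_ge0 ?(ltW m0) ?(ltW r0) //=.
by rewrite mulrAC ler_pdivrMr // ler_pM2l // le_max lexx orbT.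
Qed.

(** In the chart below, this is the radius of the circle at depth 2, where freezing is complete. *)
Let rim := l + 2.
Let rim_gt0 : 0 < rim. Proof. by rewrite addr_gt0. Qed.

(** Inside the circle of radius [l] the chart is the vertical projection of the hemisphere; outside,
    the distance to this circle is the depth in the cylinder. In [chart_z] the square root is 0
    outside, as that of a negative number. *)
Definition chart_x (a b : R) : R := shrink l (hypot a b) * a.
Definition chart_y (a b : R) : R := shrink l (hypot a b) * b.
Definition chart_z (a b : R) : R :=
  Num.sqrt (l * l - (a * a + b * b)) - Num.max 0 (hypot a b - l).

Lemma chart_shape (X : 'rV[R]_6) a b : co 0 X = chart_x a b -> co 1 X = chart_y a b ->
  co 2 X = chart_z a b -> shape X = l * l.
Proof.
rewrite /shape /zplus /chart_x /chart_y /chart_z => -> -> ->.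
have h0 := hypot_ge0 a b; have hh := hypot_sqr a b.
have [hl|hl] := leP (hypot a b) l.
  rewrite shrink_id // !mul1r (max_l (y := hypot a b - l)) ?subr_le0 // subr0 max_r ?sqrtr_ge0 //.
  by rewrite -[_ * Num.sqrt _]expr2 sqr_sqrtr; [ring|rewrite -hh subr_ge0 ler_pM].
rewrite ler0_sqrtr; last by rewrite -hh subr_le0 ler_pM // ltW.
rewrite (max_r (y := hypot a b - l)); last by lra.
rewrite max_l; last by lra.
rewrite /shrink max_r ?(ltW hl) //.
have hn : hypot a b != 0 by rewrite gt_eqF // (lt_trans l_gt0).
rewrite (_ : _ + _ + _ = l * l * (a * a + b * b) / (hypot a b * hypot a b)); last by field.
by rewrite hh mulfK // -hh mulf_neq0.
Qed.

(** The factor [1 + zminus / l] stretches the radius [l] of the cylinder to [l] plus the depth, and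
    is 1 on the hemisphere. *)
Lemma chart_inv (X : 'rV[R]_6) a b : shape X = l * l ->
  a = co 0 X * (1 + zminus X / l) -> b = co 1 X * (1 + zminus X / l) ->
  [/\ co 0 X = chart_x a b, co 1 X = chart_y a b & co 2 X = chart_z a b].
Proof.
have ln : l != 0 by rewrite gt_eqF.
rewrite /shape /zplus /zminus /chart_x /chart_y /chart_z.
have [z0|z0] := leP 0 (co 2 X).
  rewrite (max_l (y := - _)) ?oppr_le0 // mul0r addr0 !mulr1 => H -> ->.
  have hh := hypot_sqr (co 0 X) (co 1 X).
  have hl : hypot (co 0 X) (co 1 X) <= l.
    by apply: le_of_sqr; [exact: ltW|rewrite hh -H lerDl -expr2 sqr_ge0].
  rewrite shrink_id // !mul1r max_l ?subr_le0 // subr0; split=> //.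
  by rewrite -H addrAC subrr add0r -expr2 sqrtr_sqr ger0_norm.
have nz : 0 <= - co 2 X by rewrite oppr_ge0 ltW.
rewrite (max_r (x := 0) (y := - _)) // mulr0 addr0 => H -> ->.
set s := 1 + _; have s1 : 1 < s by rewrite /s ltrDl divr_gt0 // oppr_gt0.
have hE : hypot (co 0 X * s) (co 1 X * s) = l * s.
  rewrite /hypot (_ : _ + _ = (l * s) ^+ 2).
    by rewrite sqrtr_sqr ger0_norm // mulr_ge0 // ltW // (lt_trans ltr01).
  by rewrite exprMn [l ^+ 2]expr2 -H; ring.
have ls : l < l * s by rewrite ltr_pMr.
have sn : s != 0 by rewrite gt_eqF // (lt_trans ltr01).
rewrite hE /shrink max_r ?(ltW ls) // ler0_sqrtr; last first.
  by rewrite -hypot_sqr hE subr_le0 ler_pM // ltW.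
rewrite max_r; last by lra.
split; [by field; rewrite ln sn|by field; rewrite ln sn|].
by rewrite /s; field.
Qed.

Definition hypot3 (a b d : R) : R := Num.sqrt (a * a + b * b + d * d).

Lemma hypot3_sqr a b d : hypot3 a b d * hypot3 a b d = a * a + b * b + d * d.
Proof. by rewrite -expr2 sqr_sqrtr // !addr_ge0 // -expr2 sqr_ge0. Qed.

Lemma hypot3_ge0 a b d : 0 <= hypot3 a b d. Proof. exact: sqrtr_ge0. Qed.

Section Continuity.
Context {T : topologicalType}.
Implicit Types h k : T -> R.

Lemma cont_sqrt h : continuous h -> continuous (fun x => Num.sqrt (h x)).
Proof. by move=> hc x; apply: continuous_comp; [exact: hc|exact: sqrt_continuous]. Qed.

Lemma cont_shrink r h : 0 < r -> continuous h -> continuous (fun x => shrink r (h x)).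
Proof.
move=> r0 hc; apply: contM; first exact: cont_cst.
move=> x; apply: cvgV; first by rewrite gt_eqF // lt_max r0.
exact: (cont_max _ _ (cont_cst r) hc).
Qed.

Lemma cont_hypot h k : continuous h -> continuous k -> continuous (fun x => hypot (h x) (k x)).
Proof.
by move=> hc kc; apply: cont_sqrt; apply: contD; apply: contM.
Qed.

Lemma cont_hypot3 h k i : continuous h -> continuous k -> continuous i ->
  continuous (fun x => hypot3 (h x) (k x) (i x)).
Proof.
move=> hc kc ic; apply: cont_sqrt.
by apply: (contD (fun x => h x * h x + k x * k x)); [apply: contD|]; apply: contM.
Qed.

Lemma cont_chart_x h k : continuous h -> continuous k -> continuous (fun x => chart_x (h x) (k x)).
Proof. by move=> hc kc; apply: contM => //; apply: cont_shrink => //; exact: cont_hypot. Qed.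

Lemma cont_chart_y h k : continuous h -> continuous k -> continuous (fun x => chart_y (h x) (k x)).
Proof. by move=> hc kc; apply: contM => //; apply: cont_shrink => //; exact: cont_hypot. Qed.

Lemma cont_chart_z h k : continuous h -> continuous k -> continuous (fun x => chart_z (h x) (k x)).
Proof.
move=> hc kc; apply: contB.
  apply: cont_sqrt; apply: contB; first exact: cont_cst.
  by apply: contD; apply: contM.
apply: (cont_max (fun=> 0)); first exact: cont_cst.
by apply: contB; [exact: cont_hypot|exact: cont_cst].
Qed.

Lemma cont_zminus (Y : T -> 'rV[R]_6) : continuous Y -> continuous (fun x => zminus (Y x)).
Proof.
move=> Yc; apply: (cont_max (fun=> 0)); first exact: cont_cst.
rewrite (_ : (fun x => _) = fun x => 0 - co 2 (Y x)); last by apply/funext => x; rewrite sub0r.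
by apply: contB; [exact: cont_cst|exact: cont_coord].
Qed.

End Continuity.

Definition disc (a b : R) : R := shrink rim (hypot a b).
Definition ball3 (a b d : R) : R := shrink W (hypot3 a b d).

Lemma disc_le a b : hypot (disc a b * a) (disc a b * b) <= rim.
Proof.
have /andP[s0 sl] := shrink_mul rim (hypot a b) rim_gt0 (hypot_ge0 a b).
apply: le_of_sqr; first exact: ltW.
rewrite hypot_sqr (_ : _ + _ = (disc a b * hypot a b) * (disc a b * hypot a b)).
  by rewrite ler_pM.
by rewrite [RHS]mulrACA hypot_sqr; ring.
Qed.

Lemma ball3_le a b d k : k = ball3 a b d ->
  k * a * (k * a) + k * b * (k * b) + k * d * (k * d) <= W * W.
Proof.
have /andP[s0 sl] := shrink_mul W (hypot3 a b d) W_gt0 (hypot3_ge0 a b d).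
move=> ->; set k' := ball3 a b d.
rewrite (_ : _ + _ + _ = (k' * hypot3 a b d) * (k' * hypot3 a b d)); first by rewrite ler_pM.
by rewrite [RHS]mulrACA hypot3_sqr; ring.
Qed.

(** The retractions come first, so that every vector of R^5 yields an admissible state and Brouwer's
    theorem can be used on a cube. *)
Definition start (X : 'rV[R]_5) : 'rV[R]_6 :=
  let s := disc (co 0 X) (co 1 X) in
  let k := ball3 (co 2 X) (co 3 X) (co 4 X) in
  mk [:: chart_x (s * co 0 X) (s * co 1 X); chart_y (s * co 0 X) (s * co 1 X);
         chart_z (s * co 0 X) (s * co 1 X); k * co 2 X; k * co 3 X; k * co 4 X].

Lemma start_shape X : shape (start X) = l * l.
Proof. by apply: chart_shape; rewrite co_mk. Qed.

Lemma start_energy X : energy (start X) <= W * W.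
Proof. by rewrite /energy !co_mk //; exact: ball3_le. Qed.

Lemma start_cont : continuous start.
Proof.
have cc k : continuous (fun X : 'rV[R]_5 => co k X) by exact: coord_continuous.
have sc : continuous (fun X : 'rV[R]_5 => disc (co 0 X) (co 1 X)).
  by apply: cont_shrink => //; exact: cont_hypot.
have kc : continuous (fun X : 'rV[R]_5 => ball3 (co 2 X) (co 3 X) (co 4 X)).
  by apply: cont_shrink => //; exact: cont_hypot3.
have ac := contM _ _ sc (cc 0%N); have bc := contM _ _ sc (cc 1%N).
apply: cont_rV => i.
rewrite (_ : (fun X => _) = fun X => nth 0 [:: chart_x (disc (co 0 X) (co 1 X) * co 0 X)
    (disc (co 0 X) (co 1 X) * co 1 X);
    chart_y (disc (co 0 X) (co 1 X) * co 0 X) (disc (co 0 X) (co 1 X) * co 1 X);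
    chart_z (disc (co 0 X) (co 1 X) * co 0 X) (disc (co 0 X) (co 1 X) * co 1 X);
    ball3 (co 2 X) (co 3 X) (co 4 X) * co 2 X; ball3 (co 2 X) (co 3 X) (co 4 X) * co 3 X;
    ball3 (co 2 X) (co 3 X) (co 4 X) * co 4 X] i); last by apply/funext => X; rewrite mk_ord.
case: i => -[|[|[|[|[|[|i]]]]]] //= _.
- exact: cont_chart_x.
- exact: cont_chart_y.
- exact: cont_chart_z.
- exact: contM.
- exact: contM.
- exact: contM.
Qed.

(** * The period map and its fixed point *)

Variables (tau Q : R).
Hypothesis tau_gt0 : 0 < tau.
Hypotheses (Fx_bnd : forall t, `|Fx t| <= Q) (Fy_bnd : forall t, `|Fy t| <= Q).
Hypotheses (b1_bnd : forall t, `|b1 t| <= Q) (b2_bnd : forall t, `|b2 t| <= Q).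
Hypotheses (b3_bnd : forall t, `|b3 t| <= Q).
Hypotheses (Fx_cont : continuous Fx) (Fy_cont : continuous Fy).
Hypotheses (b1_cont : continuous b1) (b2_cont : continuous b2) (b3_cont : continuous b3).
Hypotheses (Fx_per : periodic Fx tau) (Fy_per : periodic Fy tau).
Hypotheses (b1_per : periodic b1 tau) (b2_per : periodic b2 tau) (b3_per : periodic b3 tau).

Lemma fld_per t X : fld (t + tau) X = fld t X.
Proof.
rewrite /fld /ext_field /dw1 /dw2 /dw3 /f1 /f2 /f3 /force1 /force2 /force3.
by rewrite Fx_per Fy_per b1_per b2_per b3_per.
Qed.

Definition back_x (Y : 'rV[R]_6) : R := co 0 Y * (1 + zminus Y / l).
Definition back_y (Y : 'rV[R]_6) : R := co 1 Y * (1 + zminus Y / l).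

(* Brouwer is applied to [q |-> proj (2 q - q')], with [q'] the position after one period, because
   the position is repelled by the rim of the disc while [w] is confined to its ball. *)
Definition circuit (Z : 'rV[R]_6 -> 'rV[R]_6) (X : 'rV[R]_5) : 'rV[R]_5 :=
  let Y := Z (start X) in
  let s := disc (co 0 X) (co 1 X) in
  let a := 2 * (s * co 0 X) - back_x Y in
  let b := 2 * (s * co 1 X) - back_y Y in
  mk [:: disc a b * a; disc a b * b; co 3 Y; co 4 Y; co 5 Y].

Lemma circuit_cont Z : continuous Z -> continuous (circuit Z).
Proof.
move=> Zc.
have cc k : continuous (fun X : 'rV[R]_5 => co k X) by exact: coord_continuous.
have sc : continuous (fun X : 'rV[R]_5 => disc (co 0 X) (co 1 X)).
  by apply: cont_shrink => //; exact: cont_hypot.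
have Yc : continuous (fun X => Z (start X)).
  by move=> X; apply: continuous_comp; [exact: start_cont|exact: Zc].
have yc k : continuous (fun X => co k (Z (start X))) by exact: cont_coord.
have zc : continuous (fun X => 1 + zminus (Z (start X)) / l).
  by apply: contD; [exact: cont_cst|apply: contM; [exact: cont_zminus|exact: cont_cst]].
pose a X := 2 * (disc (co 0 X) (co 1 X) * co 0 X) - back_x (Z (start X)).
pose b X := 2 * (disc (co 0 X) (co 1 X) * co 1 X) - back_y (Z (start X)).
have ac : continuous a.
  by apply: contB; [apply: contM; [exact: cont_cst|exact: contM]|exact: contM].
have bc : continuous b.
  by apply: contB; [apply: contM; [exact: cont_cst|exact: contM]|exact: contM].
have dc : continuous (fun X => disc (a X) (b X)).
  by apply: cont_shrink => //; exact: cont_hypot.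
apply: cont_rV => i.
rewrite (_ : (fun X => _) = fun X => nth 0 [:: disc (a X) (b X) * a X; disc (a X) (b X) * b X;
  co 3 (Z (start X)); co 4 (Z (start X)); co 5 (Z (start X))] i); last first.
  by apply/funext => X; rewrite mk_ord.
by case: i => -[|[|[|[|[|i]]]]] //= _; exact: contM.
Qed.

Lemma row6P (X Y : 'rV[R]_6) : co 0 X = co 0 Y -> co 1 X = co 1 Y -> co 2 X = co 2 Y ->
  co 3 X = co 3 Y -> co 4 X = co 4 Y -> co 5 X = co 5 Y -> X = Y.
Proof.
move=> *; apply/rowP => i; rewrite !co_ord.
by case: i => -[|[|[|[|[|[|i]]]]]].
Qed.

(** A point [q] of the rim sinks vertically, so [q' = s q] in the chart with [s > 1], and
    [2 q - q' = (2 - s) q]. If [q] is a positive multiple of this, then [0 < 2 - s < 1], which puts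
    [2 q - q'] inside the disc. *)
Lemma rim_bounces y X a b : solves fld y -> y 0 = start X ->
  hypot (co 0 X) (co 1 X) = rim ->
  a = 2 * co 0 X - back_x (y tau) -> b = 2 * co 1 X - back_y (y tau) ->
  rim < hypot a b -> co 0 X = disc a b * a -> co 1 X = disc a b * b -> False.
Proof.
move=> ysol y0 hrim aE bE hab pE qE.
have s0 : shape (y 0) = l * l by rewrite y0 start_shape.
have e0 : energy (y 0) <= W * W by rewrite y0 start_energy.
have d1 : disc (co 0 X) (co 1 X) = 1 by rewrite /disc shrink_id // hrim.
have lr : l < rim by rewrite ltrDl.
have [x0 xy0 z0] : [/\ co 0 (y 0) = l / rim * co 0 X, co 1 (y 0) = l / rim * co 1 X
    & co 2 (y 0) = - 2].
  rewrite y0 !co_mk //= d1 !mul1r /chart_x /chart_y /chart_z hrim /shrink max_r ?(ltW lr) //.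
  split=> //; rewrite ler0_sqrtr; last by rewrite -hypot_sqr hrim subr_le0 ler_pM // ltW.
  by rewrite max_r /rim; lra.
have [x1 xy1 z1] := sol_deep y ysol s0 tau tau_gt0 e0 z0.
pose s := l / rim * (1 + zminus (y tau) / l).
have zm : zminus (y tau) = - co 2 (y tau) by rewrite /zminus max_r //; lra.
have ln : l != 0 by rewrite gt_eqF.
have rn : rim != 0 by rewrite gt_eqF.
have s1 : 1 < s.
  rewrite /s zm (_ : _ * _ = (l - co 2 (y tau)) / rim); last by field; rewrite ln rn.
  by rewrite ltr_pdivlMr // mul1r /rim; lra.
have aE' : a = (2 - s) * co 0 X by rewrite aE /back_x x1 x0 /s; ring.
have bE' : b = (2 - s) * co 1 X by rewrite bE /back_y xy1 xy0 /s; ring.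
have pq := hypot_sqr (co 0 X) (co 1 X); rewrite hrim in pq.
have d0 : 0 < disc a b by rewrite /disc /shrink divr_gt0 // lt_max rim_gt0.
set p := co 0 X in aE' pE pq *; set q := co 1 X in bE' qE pq *.
set k := disc a b in d0 pE qE *.
have pk : p = k * (2 - s) * p by rewrite -mulrA -aE'.
have qk : q = k * (2 - s) * q by rewrite -mulrA -bE'.
(* Pairing the two equations with [(p, q)], a vector of norm [rim], avoids dividing by a coordinate
   that may be 0. *)
have E : k * (2 - s) = 1.
  apply: (@mulfI _ (rim * rim)); first by rewrite mulf_neq0.
  have e1 : p * p = p * (k * (2 - s) * p) by rewrite -pk.
  have e2 : q * q = q * (k * (2 - s) * q) by rewrite -qk.
  by rewrite mulr1 pq {2}e1 {2}e2; ring.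
have s2 : 0 < 2 - s by rewrite -(pmulr_rgt0 _ d0) E.
suff : hypot a b <= rim by rewrite leNgt hab.
apply: le_of_sqr; first exact: ltW.
rewrite hypot_sqr aE' bE' (_ : _ + _ = (2 - s) * (2 - s) * (rim * rim)); last by rewrite pq; ring.
by rewrite ler_piMl ?mulr_ge0 ?(ltW rim_gt0) // mulr_ile1 ?(ltW s2) //; lra.
Qed.

Lemma closed_orbit : exists y : R -> 'rV[R]_6, [/\ solves fld y, periodic y tau,
  shape (y 0) = l * l & energy (y 0) <= W * W].
Proof.
have [L [M [L0 fL fM]]] := ext_field_lip l m g mu K W Fx Fy b1 b2 b3 l_gt0 W_gt0 Q
  Fx_bnd Fy_bnd b1_bnd b2_bnd b3_bnd.
have fC X i : continuous (fun t => fld t X 0 i) by exact: ext_field_cont.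
have [Phi [Phi0 Phis Phic]] := global_flow fld L M L0 fC fL fM.
have e0 X : energy (Phi (start X) 0) <= W * W by rewrite Phi0 start_energy.
have s0 X : shape (Phi (start X) 0) = l * l by rewrite Phi0 start_shape.
have e1 X : energy (Phi (start X) tau) <= W * W by exact: sol_energy (Phis _) (s0 X) _ (ltW tau_gt0) (e0 X).
have s1 X : shape (Phi (start X) tau) = l * l by rewrite (sol_shape _ (Phis _)).
have sq (u : R) : 0 <= u * u by rewrite -expr2 sqr_ge0.
have rW : 0 < rim + W by rewrite addr_gt0.
(* Each coordinate of a value of [circuit] is bounded by [rim] or by [W], for any argument, so the
   cube of radius [rim + W] is mapped into itself. *)
have [X j|X [_ XE]] := brouwer_cube (rim + W) (circuit (Phi^~ tau)) rW (circuit_cont _ (Phic tau)).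
  move=> i; rewrite /circuit; set a := _ - back_x _; set b := _ - back_y _.
  have h := hypot_sqr (disc a b * a) (disc a b * b).
  have h2 := ler_pM (hypot_ge0 _ _) (hypot_ge0 _ _) (disc_le a b) (disc_le a b).
  have := e1 X; rewrite /energy.
  have := sq (co 3 (Phi (start X) tau)); have := sq (co 4 (Phi (start X) tau)).
  have := sq (co 5 (Phi (start X) tau)); have := sq (disc a b * a); have := sq (disc a b * b).
  move=> ? ? ? ? ? ?.
  have small (u : R) : u * u <= rim * rim \/ u * u <= W * W -> `|u| <= rim + W.
    case=> hu; [apply: (@le_trans _ _ rim)|apply: (@le_trans _ _ W)].
    - by apply: norm_le_of_sqr => //; exact: ltW.
    - by rewrite lerDl ltW.
    - by apply: norm_le_of_sqr => //; exact: ltW.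
    - by rewrite lerDr ltW.
  rewrite mk_ord; apply: small.
  by case: i => -[|[|[|[|[|i]]]]] //= _; [left|left|right|right|right]; lra.
pose y := Phi (start X).
have ysol : solves fld y by exact: Phis.
have y0 : y 0 = start X by exact: Phi0.
have XC k : co k (circuit (Phi^~ tau) X) = co k X by rewrite XE.
have := XC 4; have := XC 3; have := XC 2; have := XC 1; have := XC 0%N.
rewrite !co_mk //=.
set dX := disc (co 0 X) (co 1 X); set a := _ - back_x _; set b := _ - back_y _.
move=> pE qE wE1 wE2 wE3.
have hX : hypot (co 0 X) (co 1 X) <= rim by rewrite -pE -qE disc_le.
have dX1 : dX = 1 by rewrite /dX /disc shrink_id.
(* If [2 q - q'] lies in the disc, the retraction fixes it and [q = 2 q - q'] gives [q' = q].
   Otherwise its retraction [q] lies on the rim, which [rim_bounces] excludes. *)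
have [bx by_] : co 0 X = back_x (y tau) /\ co 1 X = back_y (y tau).
  have [hab|hab] := leP (hypot a b) rim.
    move: pE qE; rewrite /disc shrink_id // !mul1r /a /b dX1 !mul1r -/(y tau).
    by split; lra.
  exfalso; apply: (rim_bounces y X a b ysol y0 _ _ _ hab) => //.
  - rewrite -pE -qE /hypot.
    rewrite (_ : _ + _ = rim ^+ 2); first by rewrite sqrtr_sqr gtr0_norm.
    have hn : hypot a b != 0 by rewrite gt_eqF // (lt_trans rim_gt0).
    rewrite /disc /shrink max_r ?(ltW hab) // (_ : _ + _ = rim ^+ 2 * (a * a + b * b) / (hypot a b * hypot a b)).
      by rewrite -hypot_sqr mulfK // mulf_neq0.
    by field.
  - by rewrite /a dX1 mul1r.
  - by rewrite /b dX1 mul1r.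
have [c0 c1 c2] := chart_inv (y tau) _ _ (s1 X) bx by_.
have ytau : y tau = y 0.
  (* The last three coordinates of the fixed point are those of [w] after one period, which already
     lie in the ball. *)
  have k1 : ball3 (co 2 X) (co 3 X) (co 4 X) = 1.
    rewrite /ball3 shrink_id //; apply: le_of_sqr; first exact: ltW.
    by rewrite hypot3_sqr -wE1 -wE2 -wE3; exact: e1.
  rewrite y0; apply: row6P; rewrite [RHS]co_mk //= -/dX ?dX1 ?k1 ?mul1r //.
exists y; split=> //; [|by rewrite y0 start_shape|by rewrite y0 start_energy].
have yshift : solves fld (fun t => y (t + tau)).
  by move=> t i; rewrite -fld_per; apply: (der_shift (f := fun s => y s 0 i)); exact: ysol.
by move=> t; apply: (solves_uniq fld L L0 fL _ _ yshift ysol); rewrite add0r.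
Qed.

Lemma periodic_motion : exists r1 r2 r3 u1 u2 u3 : R -> R,
  [/\ forall t, r1 t * r1 t + r2 t * r2 t + r3 t * r3 t = l * l,
      [/\ periodic r1 tau, periodic r2 tau & periodic r3 tau],
      forall t, 0 < r3 t,
      forall t : R, [/\ is_derive t 1 r1 (u1 t), is_derive t 1 r2 (u2 t) & is_derive t 1 r3 (u3 t)] &
      forall t : R, exists lam : R,
  [/\ exists2 d, is_derive t 1 u1 d & m * d = force1 mu Fx b2 b3 t (u1 t) (u2 t) (u3 t) + lam * r1 t,
      exists2 d, is_derive t 1 u2 d & m * d = force2 mu Fy b1 b3 t (u1 t) (u2 t) (u3 t) + lam * r2 t
    & exists2 d, is_derive t 1 u3 d & m * d = force3 m g mu b1 b2 t (u1 t) (u2 t) (u3 t) + lam * r3 t]].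
Proof.
have [y [ysol yp s0 e0]] := closed_orbit.
(* The barrier controls the energy only forward in time; periodicity covers negative times. *)
have en t : energy (y t) <= W * W.
  by have [s /andP[s0' _] <-] := periodic_mod y tau tau_gt0 yp t; exact: sol_energy.
have z0 := sol_positive y ysol s0 en tau tau_gt0 yp.
exists (fun t => co 0 (y t)), (fun t => co 1 (y t)), (fun t => co 2 (y t)).
exists (fun t => v1 (y t)), (fun t => v2 (y t)), (fun t => v3 (y t)).
have fr t : freeze (y t) = 1 by rewrite /freeze max_r ?min_l //; have := z0 t; lra.
have zm t : zminus (y t) = 0 by rewrite /zminus max_l // oppr_le0 ltW.
split=> //.
- by move=> t; rewrite -s0 -(sol_shape y ysol t) /shape /zplus max_r // ltW.
- by split=> t; rewrite yp.
- move=> t; have := sol_x y ysol t; have := sol_y y ysol t; have := sol_z y ysol t.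
  by rewrite fr zm !mul1r mulr0 subr0.
- exact: sol_accel.
Qed.

End Dynamics.

(** * Vectors of the three-dimensional space *)

Section Vectors3.
Context {R : realType}.
Implicit Types u v : 'rV[R]_3.

Lemma dot_co u v : dot u v = co 0 u * co 0 v + co 1 u * co 1 v + co 2 u * co 2 v.
Proof.
rewrite /dot; under eq_bigr => i _ do rewrite !co_ord.
by rewrite !big_ord_recr big_ord0 /= add0r.
Qed.

Lemma co_delta k j : (k < 3)%N -> (j < 3)%N ->
  co k (delta_mx 0 (inord j) : 'rV[R]_3) = (k == j)%:R.
Proof. by move=> k3 j3; rewrite /co mxE eqxx -val_eqE /= !inordK. Qed.

Lemma co_ex k : (k < 3)%N -> co k (e_x : 'rV[R]_3) = (k == 0)%:R.
Proof. by move=> k3; rewrite /e_x co_delta. Qed.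
Lemma co_ey k : (k < 3)%N -> co k (e_y : 'rV[R]_3) = (k == 1)%:R.
Proof. by move=> k3; rewrite /e_y co_delta. Qed.
Lemma co_ez k : (k < 3)%N -> co k (e_z : 'rV[R]_3) = (k == 2)%:R.
Proof. by move=> k3; rewrite /e_z co_delta. Qed.

Lemma coD k u v : co k (u + v) = co k u + co k v. Proof. by rewrite /co mxE. Qed.
Lemma coN k u : co k (- u) = - co k u. Proof. by rewrite /co mxE. Qed.
Lemma coZ k (a : R) u : co k (a *: u) = a * co k u. Proof. by rewrite /co mxE. Qed.

Definition coE := (coD, coN, coZ).

Lemma dot_ex u : dot u e_x = co 0 u.
Proof. by rewrite dot_co !co_ex //= !mulr0 mulr1 !addr0. Qed.
Lemma dot_ey u : dot u e_y = co 1 u.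
Proof. by rewrite dot_co !co_ey //= !mulr0 mulr1 addr0 add0r. Qed.
Lemma dot_ez u : dot u e_z = co 2 u.
Proof. by rewrite dot_co !co_ez //= !mulr0 mulr1 !add0r. Qed.

Lemma co0_cross u v : co 0 (cross u v) = co 1 u * co 2 v - co 2 u * co 1 v.
Proof. by rewrite /cross !coE !dot_ex !dot_ey !dot_ez co_ex // co_ey // co_ez //=; ring. Qed.
Lemma co1_cross u v : co 1 (cross u v) = co 2 u * co 0 v - co 0 u * co 2 v.
Proof. by rewrite /cross !coE !dot_ex !dot_ey !dot_ez co_ex // co_ey // co_ez //=; ring. Qed.
Lemma co2_cross u v : co 2 (cross u v) = co 0 u * co 1 v - co 1 u * co 0 v.
Proof. by rewrite /cross !coE !dot_ex !dot_ey !dot_ez co_ex // co_ey // co_ez //=; ring. Qed.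

Lemma row3P u v : co 0 u = co 0 v -> co 1 u = co 1 v -> co 2 u = co 2 v -> u = v.
Proof.
by move=> *; apply/rowP => i; rewrite !co_ord; case: i => -[|[|[|i]]].
Qed.

Lemma der_row3 (a1 a2 a3 : R -> R) (d1 d2 d3 t : R) :
  is_derive t 1 a1 d1 -> is_derive t 1 a2 d2 -> is_derive t 1 a3 d3 ->
  derivable (fun s => mk [:: a1 s; a2 s; a3 s] : 'rV[R]_3) t 1 /\
  derive1 (fun s => mk [:: a1 s; a2 s; a3 s] : 'rV[R]_3) t = mk [:: d1; d2; d3].
Proof.
move=> D1 D2 D3.
have D (i : 'I_1) (j : 'I_3) :
    is_derive t 1 (fun s => (mk [:: a1 s; a2 s; a3 s] : 'rV[R]_3) i j) (mk [:: d1; d2; d3] i j).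
  rewrite (ord1 i) mk_ord (_ : (fun s => _) = fun s => nth 0 [:: a1 s; a2 s; a3 s] j); last first.
    by apply/funext => s; rewrite mk_ord.
  by case: j => -[|[|[|j]]].
have dd : derivable (fun s => mk [:: a1 s; a2 s; a3 s] : 'rV[R]_3) t 1.
  by apply/derivable_mxP => i j; have [] := D i j.
split=> //; rewrite derive1E derive_mx //; apply/matrixP => i j.
by rewrite mxE; have [_ ->] := D i j.
Qed.

End Vectors3.

Lemma periodic_bounded {R : realType} (f : R -> R) (tau : R) : 0 < tau ->
  continuous f -> periodic f tau -> exists Q, forall t, `|f t| <= Q.
Proof.
move=> tau0 fc fp.
have nc : continuous (fun t => `|f t|) by move=> t; apply: cvg_norm; exact: fc.
have [t0 _ H] := @EVT_max R (fun t => `|f t|) 0 tau (ltW tau0) (continuous_subspaceT nc).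
exists `|f t0| => t; have [s s0 <-] := periodic_mod f tau tau0 fp t.
by apply: H; rewrite in_itv.
Qed.

Theorem theorem2p1 (R : realType) (l m g tau : R)
    (Fx Fy : R -> R) (B : R -> 'rV[R]_3) (c mu : R)
    (l_gt0 : 0 < l) (m_gt0 : 0 < m) (g_gt0 : 0 < g) (tau_gt0 : 0 < tau)
    (Fx_cont : continuous Fx) (Fy_cont : continuous Fy) (B_cont : continuous B)
    (Fx_per : periodic Fx tau) (Fy_per : periodic Fy tau)
    (B_per : periodic B tau)
    (c_gt0 : 0 < c)
    (Hc : forall v : 'rV[R]_3, dot v e_z = 0 -> m / 2 * dot v v <= c ->
      forall t : R, dot (cross v (B t)) e_z < m * g)
    (mu_gt0 : 0 < mu)
    (Hmu : sup [set Num.sqrt (m / (2 * c))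
                    * (enorm (horizontal_force Fx Fy t) + m * g)
               | t in `[0, tau]] < mu) :
  exists rho : R -> 'rV[R]_3,
    [/\ pendulum_solution l m g mu (horizontal_force Fx Fy) B rho,
        periodic rho tau
      & forall t : R, 0 < dot (rho t) e_z].
Proof.
have FE t : [/\ co 0 (horizontal_force Fx Fy t) = Fx t, co 1 (horizontal_force Fx Fy t) = Fy t
    & co 2 (horizontal_force Fx Fy t) = 0].
  by rewrite /horizontal_force !coE !co_ex ?co_ey //=; split; ring.
have enE t : enorm (horizontal_force Fx Fy t) = Num.sqrt (Fx t * Fx t + Fy t * Fy t).
  by rewrite /enorm dot_co; have [-> -> ->] := FE t; rewrite mul0r addr0.
(* The inverse of this speed is the factor [sqrt (m / (2 c))] in the hypothesis on [mu], as [qV]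
   records. *)
pose V := Num.sqrt (2 * c / m).
have V2 : V * V = 2 * c / m by rewrite -expr2 sqr_sqrtr // divr_ge0 ?mulr_ge0 // ltW.
have V_gt0 : 0 < V by rewrite sqrtr_gt0 divr_gt0 // mulr_gt0.
have mn : m != 0 by rewrite gt_eqF.
have cn : c != 0 by rewrite gt_eqF.
have V_sqr : m / 2 * (V * V) = c by rewrite V2; field.
have qV : Num.sqrt (m / (2 * c)) * V = 1.
  rewrite /V -sqrtrM; last by rewrite divr_ge0 ?mulr_ge0 // ltW.
  by rewrite (_ : _ * _ = 1) ?sqrtr1 //; field; rewrite mn cn.
pose h t := Num.sqrt (m / (2 * c)) * (Num.sqrt (Fx t * Fx t + Fy t * Fy t) + m * g).
have hc : continuous h.
  apply: contM; first exact: cont_cst.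
  by apply: contD; [apply: cont_sqrt; apply: contD; apply: contM|exact: cont_cst].
have hmu t : h t < mu.
  have hp : periodic h tau by move=> s; rewrite /h Fx_per Fy_per.
  have [s s0 <-] := periodic_mod h tau tau_gt0 hp t.
  (* Values lie below the supremum only once the set is known to be bounded above; the maximum of
     [h] on [[0, tau]] provides a bound. *)
  apply: le_lt_trans Hmu.
  have [t1 _ H] := @EVT_max R h 0 tau (ltW tau_gt0) (continuous_subspaceT hc).
  apply: ub_le_sup; last by exists s; rewrite ?enE //= in_itv.
  by exists (h t1) => _ [r r0 <-]; rewrite enE; exact: H.
have friction t : Num.sqrt (Fx t * Fx t + Fy t * Fy t) + m * g < mu * V.
  rewrite -(ltr_pM2l (x := Num.sqrt (m / (2 * c)))); last first.
    by rewrite sqrtr_gt0 divr_gt0 // mulr_gt0.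
  by rewrite mulrCA qV mulr1; exact: hmu.
pose b1 t := co 0 (B t); pose b2 t := co 1 (B t); pose b3 t := co 2 (B t).
have gravity v1 v2 : m / 2 * (v1 * v1 + v2 * v2) <= c -> forall t, v1 * b2 t - v2 * b1 t < m * g.
  move=> vc t; have := Hc (mk [:: v1; v2; 0]).
  by rewrite dot_ez dot_co !co_mk //= mul0r addr0 => /(_ erefl vc t); rewrite dot_ez co2_cross !co_mk.
have b1c : continuous b1 by exact: cont_coord.
have b2c : continuous b2 by exact: cont_coord.
have b3c : continuous b3 by exact: cont_coord.
have b1p : periodic b1 tau by move=> t; rewrite /b1 B_per.
have b2p : periodic b2 tau by move=> t; rewrite /b2 B_per.
have b3p : periodic b3 tau by move=> t; rewrite /b3 B_per.
have [Q1 H1] := periodic_bounded Fx tau tau_gt0 Fx_cont Fx_per.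
have [Q2 H2] := periodic_bounded Fy tau tau_gt0 Fy_cont Fy_per.
have [Q3 H3] := periodic_bounded b1 tau tau_gt0 b1c b1p.
have [Q4 H4] := periodic_bounded b2 tau tau_gt0 b2c b2p.
have [Q5 H5] := periodic_bounded b3 tau tau_gt0 b3c b3p.
pose Q := Num.max Q1 (Num.max Q2 (Num.max Q3 (Num.max Q4 Q5))).
have B1 t : `|Fx t| <= Q by rewrite (le_trans (H1 t)) // /Q !le_max lexx ?orbT.
have B2 t : `|Fy t| <= Q by rewrite (le_trans (H2 t)) // /Q !le_max lexx ?orbT.
have B3 t : `|b1 t| <= Q by rewrite (le_trans (H3 t)) // /Q !le_max lexx ?orbT.
have B4 t : `|b2 t| <= Q by rewrite (le_trans (H4 t)) // /Q !le_max lexx ?orbT.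
have B5 t : `|b3 t| <= Q by rewrite (le_trans (H5 t)) // /Q !le_max lexx ?orbT.
have [r1 [r2 [r3 [u1 [u2 [u3 [rl [r1p r2p r3p] r3_gt0 rd ud]]]]]]] :=
  periodic_motion l m g mu c V Fx Fy b1 b2 b3 l_gt0 m_gt0 g_gt0 mu_gt0 V_gt0 V_sqr
    friction gravity tau Q tau_gt0 B1 B2 B3 B4 B5
    Fx_cont Fy_cont b1c b2c b3c Fx_per Fy_per b1p b2p b3p.
pose rho t : 'rV[R]_3 := mk [:: r1 t; r2 t; r3 t].
pose vel t : 'rV[R]_3 := mk [:: u1 t; u2 t; u3 t].
have rhoD t : derivable rho t 1 /\ derive1 rho t = vel t.
  by have [d1 d2 d3] := rd t; exact: der_row3.
have velE : derive1 rho = vel by apply/funext => t; have [] := rhoD t.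
exists rho; split; last 2 first.
- by move=> t; rewrite /rho r1p r2p r3p.
- by move=> t; rewrite dot_ez co_mk //=; exact: r3_gt0.
split=> [t|t|t|t].
- by rewrite /enorm dot_co !co_mk //= rl -expr2 sqrtr_sqr ger0_norm // ltW.
- by have [] := rhoD t.
- have [lam [[d1 D1 _] [d2 D2 _] [d3 D3 _]]] := ud t.
  by rewrite velE; have [] := der_row3 _ _ _ _ _ _ _ D1 D2 D3.
have [lam [[d1 D1 E1] [d2 D2 E2] [d3 D3 E3]]] := ud t.
exists lam; rewrite velE; have [_ ->] := der_row3 _ _ _ _ _ _ _ D1 D2 D3.
move: (horizontal_force Fx Fy t) (FE t) => f [f1 f2 f3].
move: (cross (vel t) (B t)) (co0_cross (vel t) (B t)) (co1_cross (vel t) (B t)) (co2_cross (vel t) (B t)) => k.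
rewrite /vel /rho !co_mk //= => k1 k2 k3.
apply: row3P; rewrite !coE !co_ez // !co_mk //=.
- by rewrite E1 /force1 f1 k1 -/(b2 t) -/(b3 t); ring.
- by rewrite E2 /force2 f2 k2 -/(b1 t) -/(b3 t); ring.
- by rewrite E3 /force3 f3 k3 -/(b1 t) -/(b2 t); ring.
Qed.
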